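(* Let $2\leq k\leq m\leq n$, $n\geq 3$, $0\leq l<k$, and $b\in\mathbb{R}$. Put $\hat a=(C_n^l/C_n^k)^{\frac{1}{k-l}}$. For $c\in\mathbb{R}$, the exterior Dirichlet problem $$\frac{S_k(D^2u)}{S_l(D^2u)}=1\ \text{ in } \mathbb{R}^n\setminus\overline{B_1},\qquad u=b\ \text{ on }\partial B_1$$ has a unique solution $u\in\Phi_m$ satisfying $$u(x)=\frac{\hat a}{2}|x|^2+c+O(|x|^{2-n}),\quad |x|\to\infty,$$ if and only if $c\in[\mu(\alpha_1),+\infty)$ when $m=k$, and $c\in[\mu(\alpha_1),\mu(\alpha_2)]$ when $m>k$, where $$\mu(\alpha)=b-\frac{\hat a}{2}+\hat a\int_1^{\infty}s\left[\left(1+\frac{\alpha}{C_n^l s^n U^l(s,\alpha)}\right)^{\frac1{k-l}}-1\right]ds,$$ $$\alpha_1:=\sup_{r>1}U_r^{-1}\left(\left(\frac{lC_n^l}{kC_n^k}\right)^{\frac1{k-l}}\right),\qquad \alpha_2:=\inf_{r>1}U_r^{-1}\left(\left(\frac{(m-l)C_n^l}{(m-k)C_n^k}\right)^{\frac1{k-l}}\right)\ (m>k),$$ and $U=U(r,\alpha)=U_r(\alpha)$ satisfies $$U^k-\frac{C_n^l}{C_n^k}U^l-\frac{\alpha}{C_n^k r^n}=0,\quad r>1,\qquad\text{and}\qquad U>\left(\frac{lC_n^l}{kC_n^k}\right)^{\frac1{k-l}}.$$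
   Context: $B_1$ is the unit ball of $\mathbb{R}^n$ and $C_n^j=\binom{n}{j}$. $S_j(D^2u)=\sigma_j(\lambda(D^2u))$ is the $j$-th elementary symmetric function of the eigenvalues $\lambda(D^2u)=(\lambda_1,\dots,\lambda_n)$ of the Hessian $D^2u$, with $S_0\equiv1$; $U^0=1$. $\Gamma_k=\{\lambda\in\mathbb{R}^n:\sigma_j(\lambda)>0,\ j=1,\dots,k\}$. A $C^2$ function $u$ is uniformly $m$-convex if $\lambda(D^2u)\in\Gamma_m$ at every point. $\Phi_m$ is the set of $u\in C^1(\mathbb{R}^n\setminus B_1)\cap C^2(\mathbb{R}^n\setminus\overline{B_1})$ that are uniformly $m$-convex (in $\mathbb{R}^n\setminus\overline{B_1}$) and radially symmetric. For fixed $r>1$, $\alpha\mapsto U_r(\alpha)$ is strictly increasing and $U_r^{-1}$ is its inverse function, i.e. $U_r^{-1}(y)=r^n(C_n^k y^k-C_n^l y^l)$; at the endpoint $y=\left(\frac{lC_n^l}{kC_n^k}\right)^{1/(k-l)}$ the value is given by the same formula (continuous extension). *)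

(* Defs.v *)
From HB Require Import structures.
From mathcomp Require Import all_boot all_order all_algebra.
From mathcomp Require Import all_classical all_reals all_analysis.
Set Implicit Arguments.
Unset Strict Implicit.
Unset Printing Implicit Defensive.
Import Order.TTheory GRing.Theory Num.Theory numFieldNormedType.Exports.
Local Open Scope classical_set_scope.
Local Open Scope ring_scope.

(* The library norm of 'rV[R]_n is the sup norm; it induces the same topology
   as the Euclidean norm [enorm], which is the |x| of the problem. *)
Definition enorm (R : realType) (n : nat) (x : 'rV[R]_n) : R :=
  Num.sqrt (\sum_(i < n) x 0 i ^+ 2).

Definition unit_sphere (R : realType) (n : nat) : set 'rV[R]_n :=
  [set x | enorm x = 1].

(* R^n \ B_1 *)
Definition ext_closed (R : realType) (n : nat) : set 'rV[R]_n :=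
  [set x | 1 <= enorm x].

(* R^n \ closure B_1 *)
Definition ext_open (R : realType) (n : nat) : set 'rV[R]_n :=
  [set x | 1 < enorm x].

Definition partial (R : realType) (n : nat) (i : 'I_n) (f : 'rV[R]_n -> R) :
    'rV[R]_n -> R :=
  fun x => 'D_(delta_mx 0 i) f x.

(* C^1 and C^2 on a set D that is meant to be open. *)
Definition C1_on (R : realType) (n : nat) (D : set 'rV[R]_n)
    (f : 'rV[R]_n -> R) : Prop :=
  {within D, continuous f} /\
  forall i : 'I_n, (forall x, D x -> derivable f x (delta_mx 0 i)) /\
                   {within D, continuous (partial i f)}.

Definition C2_on (R : realType) (n : nat) (D : set 'rV[R]_n)
    (f : 'rV[R]_n -> R) : Prop :=
  C1_on D f /\ forall i : 'I_n, C1_on D (partial i f).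

(* C^1 up to the boundary: f is continuous on R^n \ B_1, C^1 in the open
   exterior, and its first partial derivatives extend continuously to
   R^n \ B_1. *)
Definition C1_ext_closed (R : realType) (n : nat) (f : 'rV[R]_n -> R) : Prop :=
  [/\ {within @ext_closed R n, continuous f},
      C1_on (@ext_open R n) f &
      forall i : 'I_n, exists g : 'rV[R]_n -> R,
        {within @ext_closed R n, continuous g} /\
        (forall x, ext_open x -> g x = partial i f x)].

Definition hessian (R : realType) (n : nat) (u : 'rV[R]_n -> R)
    (x : 'rV[R]_n) : 'M[R]_n :=
  \matrix_(i < n, j < n) partial j (partial i u) x.

(* The eigenvalues with multiplicity, i.e. the roots of the characteristic
   polynomial. They exist in R for every real symmetric matrix, in particular
   for the Hessian of a C^2 function; their order is irrelevant since only
   symmetric functions of them are used. *)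
Definition eigvals (R : realType) (n : nat) (A : 'M[R]_n) : 'rV[R]_n :=
  xget 0 [set lam : 'rV[R]_n |
            char_poly A = \prod_(i < n) ('X - (lam 0 i)%:P)].

Definition esigma (R : realType) (n j : nat) (lam : 'rV[R]_n) : R :=
  \sum_(I : {set 'I_n} | #|I| == j) \prod_(i in I) lam 0 i.

Definition S_ (R : realType) (n j : nat) (u : 'rV[R]_n -> R) (x : 'rV[R]_n) :
    R :=
  esigma j (eigvals (hessian u x)).

Definition Gamma_ (R : realType) (n k : nat) : set 'rV[R]_n :=
  [set lam | forall j : nat, (1 <= j <= k)%N -> 0 < esigma j lam].

Definition unif_convex_on (R : realType) (n m : nat) (D : set 'rV[R]_n)
    (u : 'rV[R]_n -> R) : Prop :=
  forall x, D x -> Gamma_ m (eigvals (hessian u x)).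

Definition radial (R : realType) (n : nat) (u : 'rV[R]_n -> R) : Prop :=
  forall x y : 'rV[R]_n, ext_closed x -> enorm x = enorm y -> u x = u y.

(* Elements of Phi_m are functions on R^n \ B_1; here they are represented by
   total functions, whose values inside B_1 are irrelevant. *)
Definition Phi_ (R : realType) (n m : nat) : set ('rV[R]_n -> R) :=
  [set u | [/\ C1_ext_closed u, C2_on (@ext_open R n) u,
               unif_convex_on m (@ext_open R n) u & radial u]].

Definition dirichlet_solution (R : realType) (n k l : nat) (b : R)
    (u : 'rV[R]_n -> R) : Prop :=
  (forall x, ext_open x -> S_ k u x / S_ l u x = 1) /\
  (forall x, unit_sphere x -> u x = b).

Definition a_hat (R : realType) (n k l : nat) : R :=
  ('C(n, l)%:R / 'C(n, k)%:R) `^ (k - l)%:R^-1.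

(* u(x) = a_hat / 2 |x|^2 + c + O(|x|^(2 - n)) as |x| -> oo *)
Definition asymptotics (R : realType) (n k l : nat) (c : R)
    (u : 'rV[R]_n -> R) : Prop :=
  exists M r0 : R, forall x : 'rV[R]_n, r0 <= enorm x ->
    `|u x - (a_hat R n k l / 2 * enorm x ^+ 2 + c)|
      <= M * enorm x ^ (2%:Z - n%:Z).

Definition U_low (R : realType) (n k l : nat) : R :=
  ((l * 'C(n, l))%:R / (k * 'C(n, k))%:R) `^ (k - l)%:R^-1.

Definition is_U (R : realType) (n k l : nat) (r alpha y : R) : Prop :=
  U_low R n k l < y /\
  y ^+ k - 'C(n, l)%:R / 'C(n, k)%:R * y ^+ l
    - alpha / ('C(n, k)%:R * r ^+ n) = 0.

(* The root U(r, alpha); there is at most one, and the default value 0 is only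
   used where there is none. *)
Definition U_ (R : realType) (n k l : nat) (r alpha : R) : R :=
  xget 0 [set y | is_U n k l r alpha y].

(* The inverse of alpha |-> U_ n k l r alpha, extended to y = U_low. *)
Definition U_inv (R : realType) (n k l : nat) (r y : R) : R :=
  r ^+ n * ('C(n, k)%:R * y ^+ k - 'C(n, l)%:R * y ^+ l).

Definition alpha1 (R : realType) (n k l : nat) : R :=
  sup [set U_inv n k l r (U_low R n k l) | r in [set r : R | 1 < r]].

Definition alpha2 (R : realType) (n k l m : nat) : R :=
  inf [set U_inv n k l r
        ((((m - l) * 'C(n, l))%:R / ((m - k) * 'C(n, k))%:R)
           `^ (k - l)%:R^-1) | r in [set r : R | 1 < r]].

(* The integral is over the open half-line since U(s, alpha) is only
   prescribed for s > 1. *)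
Definition mu_ (R : realType) (n k l : nat) (b alpha : R) : R :=
  b - a_hat R n k l / 2 + a_hat R n k l *
    Rintegral (@lebesgue_measure R) `]1, +oo[
      (fun s : R =>
         s * ((1 + alpha / ('C(n, l)%:R * s ^+ n * U_ n k l s alpha ^+ l))
                `^ (k - l)%:R^-1 - 1)).

(* Main.v *)
(* For a radial function with profile f, put w = f'(r)/r. The Hessian is a
   rank-one perturbation of w I, so S_j = C_n^j r^(1-n) (r^n w^j)' / n, and the
   equation S_k = S_l says that r^n F(w(r)) is a constant alpha, where
   F(y) = C_n^k y^k - C_n^l y^l. Given this first integral, S_j > 0 for all
   j <= m amounts to U_low < w, together with w < U_high when m > k. As F is
   increasing beyond U_low and F(U_low) < 0 < F(U_high), such a w exists for all
   r > 1 iff F(U_low) <= alpha and (when m > k) alpha <= F(U_high), and these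
   bounds are alpha1 and alpha2. Integrating r w(r) gives the solution, whose
   constant at infinity is mu(alpha); mu is strictly increasing, continuous and
   unbounded above. *)
Require Import Defs.
From HB Require Import structures.
From mathcomp Require Import all_boot all_order all_algebra.
From mathcomp Require Import all_classical all_reals all_analysis.
From mathcomp Require Import measurable_realfun ring lra zify.
Import Order.TTheory GRing.Theory Num.Theory numFieldNormedType.Exports.
Set Implicit Arguments.
Unset Strict Implicit.
Unset Printing Implicit Defensive.
Local Open Scope classical_set_scope.
Local Open Scope ring_scope.

(** * Elementary symmetric functions of a rank-one perturbation *)

(** The delicate parameter is the lower endpoint alpha = F(U_low). There w(1) = U_low, and F'
    vanishes at U_low because k >= 2, so w is not differentiable at r = 1: the solution is only C^1
    up to the sphere, which is what [Phi_] asks. In the open exterior F(U_low) < 0 helps, since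
    alpha / r^n then lies strictly above F(U_low) for every r > 1. Continuity of mu up to this
    endpoint cannot come from a bound on the derivative of the inverse of F. It comes from F(y + t)
    >= F(y) + C_n^k t^k for y >= U_low and t >= 0, which gives the inverse a modulus of continuity
    independent of the point. At infinity w tends to a_hat, the positive zero of F, near which the
    inverse is controlled linearly: w - a_hat = O(r^(-n)), and integrating r (w - a_hat) leaves an
    error O(r^(2-n)) because n >= 3. *)

(** Both sides are [a * \det M] for the bordered matrix [M], eliminated once by rows and once by
    columns. Keeping the factor [a] avoids inverting it: it will be the polynomial ['X - w%:P]. *)
Lemma det_rank1_pert (A : idomainType) (n : nat) (a : A) (u : 'cV[A]_n)
    (v : 'rV[A]_n) :
  a * \det (a%:M - u *m v) = (a - (v *m u) 0 0) * a ^+ n.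
Proof.
pose M := block_mx 1%:M v u (a%:M : 'M[A]_n).
have E1 : block_mx 1%:M 0 (- u) 1%:M *m M = block_mx 1%:M v 0 (a%:M - u *m v).
  rewrite mulmx_block !mul1mx !mul0mx !addr0 mulmx1 addNr.
  by rewrite mulNmx addrC.
have E2 : M *m block_mx a%:M 0 (- u) 1%:M
          = block_mx (a%:M - v *m u) v 0 a%:M.
  rewrite mulmx_block mul1mx !mulmx0 !mulmx1 !add0r !mulmxN.
  by rewrite mul_scalar_mx mul_mx_scalar addrN.
have D1 : \det M = \det (a%:M - u *m v).
  have /(congr1 determinant) := E1.
  by rewrite det_mulmx det_lblock det_ublock !det1 !mul1r.
have /(congr1 determinant) := E2.
rewrite det_mulmx det_lblock det_ublock det1 mulr1 !det_scalar D1 expr1.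
by rewrite det_mx11 !mxE eqxx mulr1n mulrC.
Qed.

Lemma char_poly_rank1 (R : fieldType) (n : nat) (w c : R) (x : 'rV[R]_n.+1) :
  char_poly (w%:M + c *: (x^T *m x))
  = ('X - (w + c * \sum_i x 0 i ^+ 2)%:P) * ('X - w%:P) ^+ n.
Proof.
have a0 : 'X - w%:P != 0 :> {poly R} by rewrite polyXsubC_eq0.
have := det_rank1_pert ('X - w%:P) (map_mx polyC (c *: x^T)) (map_mx polyC x).
rewrite -map_mxM /= => H; apply: (mulfI a0).
transitivity (('X - w%:P) * \det (('X - w%:P)%:M
   - map_mx polyC (c *: x^T *m x))).
  congr (_ * \det _); rewrite /char_poly_mx map_mxD map_scalar_mx /=.
  by rewrite opprD addrA -raddfB /= scalemxAl.
rewrite H exprS mulrCA; congr (_ * (_ * _)).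
rewrite -map_mxM mxE polyCD opprD addrA; congr (_ - _%:P).
by rewrite mxE mulr_sumr; apply: eq_bigr => i _; rewrite !mxE mulrC -mulrA.
Qed.

(** With this generating polynomial, independence of the order of the eigenvalues becomes a
    permutation of factors, and the case of two distinct values becomes the binomial theorem. *)
Lemma esigma_gen (R : realType) (n j : nat) (lam : 'rV[R]_n) :
  esigma j lam = (\prod_(i < n) (1 + lam 0 i *: 'X))`_j.
Proof.
under eq_bigr do rewrite addrC.
rewrite bigA_distr coef_sum (bigID (fun I : {set 'I_n} => #|I| == j)) /=.
have E (I : {set 'I_n}) :
    (\prod_(i < n) (if i \in I then lam 0 i *: 'X else 1))`_j
    = \prod_(i in I) lam 0 i * (j == #|I|)%:R.
  rewrite -big_mkcond /= (eq_bigr (fun i => (lam 0 i)%:P * 'X)) => [|i _].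
    by rewrite big_split /= prodr_const -rmorph_prod /= coefCM coefXn.
  by rewrite mul_polyC.
rewrite [X in _ = _ + X]big1 ?addr0 => [|I /negPf Ij].
  by apply: eq_bigr => I /eqP Ij; rewrite E Ij eqxx mulr1.
by rewrite E eq_sym Ij mulr0.
Qed.

Lemma esigma_perm (R : realType) (n j : nat) (lam nu : 'rV[R]_n) :
  \prod_(i < n) ('X - (lam 0 i)%:P) = \prod_(i < n) ('X - (nu 0 i)%:P) ->
  esigma j lam = esigma j nu.
Proof.
move=> H; rewrite !esigma_gen; congr (polyseq _)`_j.
pose sq (v : 'rV[R]_n) := [seq v 0 i | i <- enum 'I_n].
have E (f : R -> {poly R}) (v : 'rV[R]_n) :
    \prod_(i < n) f (v 0 i) = \prod_(y <- sq v) f y.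
  by rewrite big_map big_enum.
rewrite (E (fun y => 1 + y *: 'X)) [RHS](E (fun y => 1 + y *: 'X)).
apply: perm_big; apply: prod_XsubC_eq.
by rewrite -!(E (fun y => 'X - y%:P)).
Qed.

(** [eigvals] chooses some ordering of the roots. One explicit splitting of the characteristic
    polynomial rules out the default value of [xget], and symmetric functions do not see the
    ordering. *)
Lemma esigma_eigvals (R : realType) (n j : nat) (A : 'M[R]_n) (nu : 'rV[R]_n) :
  char_poly A = \prod_(i < n) ('X - (nu 0 i)%:P) ->
  esigma j (eigvals A) = esigma j nu.
Proof.
move=> H; apply: esigma_perm; rewrite -H /eigvals.
by case: xgetP => [y _ /= -> //|/(_ nu)].
Qed.

Lemma esigma_two_valued (R : realType) (n j : nat) (w h : R) :
  esigma j.+1 (\row_(i < n.+1) (if i == ord0 then h else w))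
  = 'C(n, j.+1)%:R * w ^+ j.+1 + 'C(n, j)%:R * w ^+ j * h.
Proof.
rewrite esigma_gen big_ord_recl mxE eqxx.
rewrite (eq_bigr (fun=> 1 + w *: 'X)) => [|i _]; last by rewrite mxE.
rewrite prodr_const card_ord exprDn.
have C i : (\sum_(i0 < n.+1) (1 ^+ (n - i0) * (w *: 'X) ^+ i0 *+ 'C(n, i0))
    : {poly R})`_i = 'C(n, i)%:R * w ^+ i.
  rewrite coef_sum.
  under eq_bigr do rewrite expr1n mul1r exprZn coefMn coefZ coefXn.
  have [ltin|leni] := ltnP i n.+1; last first.
    rewrite bin_small // mul0r big1 // => i0 _.
    by rewrite gtn_eqF ?mulr0 ?mul0rn // (leq_trans (ltn_ord i0)).
  rewrite (bigD1 (Ordinal ltin)) //= eqxx mulr1 mulr_natl big1 ?addr0 // => i0.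
  rewrite -val_eqE /= eq_sym => /negPf ->.
  by rewrite mulr0 mul0rn.
rewrite mulrDl mul1r coefD C -scalerAl coefZ ['X * _]mulrC coefMX /= C.
by rewrite [h * _]mulrC.
Qed.

Lemma esigma_rank1 (R : realType) (n j : nat) (w h c : R) (x : 'rV[R]_n) :
  (0 < n)%N -> (0 < j)%N -> w + c * \sum_i x 0 i ^+ 2 = h ->
  esigma j (eigvals (w%:M + c *: (x^T *m x)))
  = 'C(n, j)%:R / n%:R * (w ^+ j.-1 * ((n%:R - j%:R) * w + j%:R * h)).
Proof.
case: n j x => [//|n] [//|j] x _ _ wh.
rewrite (@esigma_eigvals _ _ _ _ (\row_(i < n.+1)
   (if i == ord0 then h else w))).
  rewrite esigma_two_valued /=.
  have n0 : n.+1%:R != 0 :> R by rewrite pnatr_eq0.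
  apply: (mulfI n0); rewrite !mulrA [n.+1%:R * 'C(n.+1, _)%:R]mulrC mulfK //.
  have E1 : n.+1%:R * 'C(n, j)%:R = j.+1%:R * 'C(n.+1, j.+1)%:R :> R.
    by rewrite -!natrM mul_bin_diag.
  have E2 : 'C(n.+1, j.+1)%:R = 'C(n, j.+1)%:R + 'C(n, j)%:R :> R.
    by rewrite -natrD binS.
  move: E1; rewrite E2 => /eqP; rewrite -subr_eq0 => /eqP E1.
  apply/eqP; rewrite -subr_eq0 exprS; apply/eqP.
  (* After Pascal's rule the difference of the two sides is the identity [E1] times
     [w ^+ j * (h - w)]. *)
  rewrite -[RHS](mul0r (w ^+ j * (h - w))) -E1; ring.
rewrite char_poly_rank1 wh big_ord_recl mxE eqxx; congr (_ * _).
rewrite (eq_bigr (fun=> 'X - w%:P)) => [|i _]; last by rewrite mxE.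
by rewrite prodr_const card_ord.
Qed.

(** * Radial functions *)

Section RadialFunctions.
Context {R : realType} {n : nat}.
Implicit Types (x v : 'rV[R]_n) (i j : 'I_n) (u : 'rV[R]_n -> R) (f : R -> R).

(** Turns a directional derivative into the derivative of a function of one real variable, for which
    the one-variable chain rule is available. *)
Lemma is_derive_lineP (V : normedModType R) (u : V -> R) (x v : V) (d : R) :
  is_derive x v u d <-> is_derive (0 : R) 1 (fun h : R => u (h *: v + x)) d.
Proof.
have E : 'D_v u x = 'D_1 (fun h : R => u (h *: v + x)) 0.
  rewrite /derive; set g1 := fun h => h^-1 *: _; set g2 := fun h => h^-1 *: _.
  suff -> : g1 = g2 by []; rewrite funeqE /g1 /g2 => h /=.
  by rewrite addr0 scale0r add0r [_%:A]mulr1.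
have [P1 P2] := derivable1P u x v.
by split=> -[dh <-]; constructor; [exact: P1|rewrite E|exact: P2|rewrite E].
Qed.

Lemma is_derive_along_comp (V : normedModType R) (u : V -> R) f (x v : V)
    (d e : R) :
  is_derive x v u d -> is_derive (u x) 1 f e -> is_derive x v (f \o u) (e * d).
Proof.
move=> /is_derive_lineP du df; apply/is_derive_lineP.
pose g (h : R) := u (h *: v + x).
have fg : is_derive (g 0) 1 f e by rewrite /g scale0r add0r.
exact: (is_derive1_comp fg du).
Qed.

Lemma is_derive_sqr (t : R) : is_derive t 1 (fun t : R => t ^+ 2) (2 * t).
Proof.
constructor; first exact: exprn_derivable.
by rewrite exp_derive expr1 [LHS]mulr1.
Qed.

Lemma is_derive_coord x v j : is_derive x v (fun y => y 0 j) (v 0 j).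
Proof.
apply/is_derive_lineP.
rewrite (_ : (fun h => _) = (fun h : R => h * v 0 j + x 0 j)).
  by apply: is_derive_eq; rewrite addr0 scaler0 add0r [_%:A]mulr1.
by apply/funext => h; rewrite !mxE.
Qed.

Lemma enorm_ge0 x : 0 <= enorm x.
Proof. exact: sqrtr_ge0. Qed.

Lemma enorm_sqr x : enorm x ^+ 2 = \sum_(i < n) x 0 i ^+ 2.
Proof. by rewrite sqr_sqrtr // sumr_ge0 // => i _; exact: sqr_ge0. Qed.

Lemma enorm_delta i (r : R) : 0 <= r -> enorm (r *: delta_mx 0 i) = r.
Proof.
move=> r0; rewrite /enorm (bigD1 i) //= big1 => [|j ji].
  by rewrite !mxE !eqxx mulr1 addr0 sqrtr_sqr ger0_norm.
by rewrite !mxE (negPf ji) andbF mulr0 expr0n.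
Qed.

Lemma enorm_continuous : continuous (@enorm R n).
Proof.
move=> x; apply: (@continuous_comp _ _ _ (fun y : 'rV[R]_n =>
   \sum_(i < n) y 0 i ^+ 2) Num.sqrt); last exact: sqrt_continuous.
move: x; apply: continuous_big => [|i _]; first exact: add_continuous.
move=> x; apply: (@continuous_comp _ _ _ (fun y : 'rV[R]_n => y 0 i)
  (fun t : R => t ^+ 2)); first exact: coord_continuous.
exact: exprn_continuous.
Qed.

Lemma continuous_comp_enorm (g : R -> R) x : {for enorm x, continuous g} ->
  {for x, continuous (fun y : 'rV[R]_n => g (enorm y))}.
Proof.
by move=> gx; apply: (@continuous_comp _ _ _ (@enorm R n) g) => //;
  exact: enorm_continuous.
Qed.

Lemma ext_open_open : open (@ext_open R n).
Proof.
rewrite (_ : @ext_open R n = @enorm R n @^-1` [set r | 1 < r]) //.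
apply: open_comp => [x _|]; [exact: enorm_continuous|exact: open_gt].
Qed.

Lemma is_derive_enorm x i : 0 < enorm x ->
  is_derive x (delta_mx 0 i) (@enorm R n) (x 0 i / enorm x).
Proof.
move=> x0; have q0 : 0 < \sum_(j < n) x 0 j ^+ 2.
  by rewrite -enorm_sqr exprn_gt0.
have D : is_derive x (delta_mx 0 i) (fun y : 'rV[R]_n =>
    \sum_(j < n) y 0 j ^+ 2) (2 * x 0 i).
  rewrite (_ : (fun y => _) = \sum_(j < n) (fun y : 'rV[R]_n => y 0 j ^+ 2)).
    apply: is_derive_eq.
      apply: is_derive_sum => j.
      exact: (is_derive_along_comp (is_derive_coord x _ j) (is_derive_sqr _)).
    rewrite (bigD1 i) //= big1 => [|j ji]; first by rewrite !mxE !eqxx addr0 mulr1.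
    by rewrite !mxE (negPf ji) andbF mulr0.
  by apply/funext => y; rewrite fct_sumE.
apply: is_derive_eq.
  apply: (is_derive_along_comp D); exact: is_derive1_sqrt.
by rewrite -/(enorm x) invfM; field; rewrite gt_eqF.
Qed.

Section Radial.
Variables (f w w1 : R -> R) (u : 'rV[R]_n -> R).
Hypothesis uf : forall x, ext_open x -> u x = f (enorm x).
Hypothesis fw : forall r : R, 1 < r -> is_derive r 1 f (r * w r).

Lemma ext_open_near x (P : 'rV[R]_n -> Prop) : ext_open x ->
  (forall y, ext_open y -> P y) -> \forall y \near x, P y.
Proof.
move=> x1 H; have := open_nbhs_nbhs (conj ext_open_open x1).
by apply: filterS => y; exact: H.
Qed.

(** Writing the derivative of the profile as r w(r) cancels the denominator of the gradient x / |x|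
    of the norm. *)
Lemma radial_is_derive x i : ext_open x ->
  is_derive x (delta_mx 0 i) u (w (enorm x) * x 0 i).
Proof.
move=> x1; have x0 : 0 < enorm x by rewrite (lt_trans ltr01).
apply: (@near_eq_is_derive _ _ _ (f \o @enorm R n)).
  by apply: ext_open_near => // y y1; rewrite uf.
apply: is_derive_eq.
  exact: (is_derive_along_comp (is_derive_enorm i x0) (fw x1)).
by field; rewrite gt_eqF.
Qed.

Lemma radial_partial x i : ext_open x -> partial i u x = w (enorm x) * x 0 i.
Proof. by move=> x1; have [_] := radial_is_derive i x1. Qed.

Hypothesis ww1 : forall r : R, 1 < r -> is_derive r 1 w (w1 r).

Lemma radial_is_derive2 x i j : ext_open x ->
  is_derive x (delta_mx 0 j) (partial i u)
    (w1 (enorm x) / enorm x * (x 0 i * x 0 j) + w (enorm x) *+ (i == j)).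
Proof.
move=> x1; have x0 : 0 < enorm x by rewrite (lt_trans ltr01).
apply: (@near_eq_is_derive _ _ _ ((w \o @enorm R n) * (fun y => y 0 i))).
  by apply: ext_open_near => // y y1; rewrite radial_partial.
apply: is_derive_eq.
  apply: is_deriveM; last exact: is_derive_coord.
  exact: (is_derive_along_comp (is_derive_enorm j x0) (ww1 x1)).
rewrite /= !mxE eqxx /= /GRing.scale /=.
by rewrite mulr_natr [_ + _ *+ _]addrC; congr (_ + _); field; rewrite gt_eqF.
Qed.

Lemma radial_hessian x : ext_open x ->
  hessian u x = (w (enorm x))%:M + (w1 (enorm x) / enorm x) *: (x^T *m x).
Proof.
move=> x1; apply/matrixP => i j; rewrite !mxE big_ord1 !mxE addrC.
by have [_] := radial_is_derive2 i j x1; rewrite addrC.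
Qed.

Lemma radial_S_ x (j : nat) : (0 < n)%N -> (0 < j)%N -> ext_open x ->
  S_ j u x = 'C(n, j)%:R / n%:R * (w (enorm x) ^+ j.-1 *
    (n%:R * w (enorm x) + j%:R * (enorm x * w1 (enorm x)))).
Proof.
move=> n0 j0 x1; have x0 : 0 < enorm x by rewrite (lt_trans ltr01).
rewrite /S_ radial_hessian // (@esigma_rank1 _ _ _ _
  (w (enorm x) + enorm x * w1 (enorm x))) //; first by congr (_ * (_ * _)); ring.
by rewrite -enorm_sqr; field; rewrite gt_eqF.
Qed.

Hypothesis w1c : forall r : R, 1 < r -> {for r, continuous w1}.

Lemma radial_C2 : C2_on (@ext_open R n) u.
Proof.
have cw r : 1 < r -> {for r, continuous w}.
  by move=> r1; have [dw _] := ww1 r1; apply/differentiable_continuous/derivable1_diffP.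
have cf r : 1 < r -> {for r, continuous f}.
  by move=> r1; have [df _] := fw r1; apply/differentiable_continuous/derivable1_diffP.
have cc i : continuous (fun y : 'rV[R]_n => y 0 i) by exact: coord_continuous.
have cpart i : {within @ext_open R n, continuous (partial i u)}.
  apply: (@subspace_eq_continuous _ _ _ (fun y => w (enorm y) * y 0 i)).
    by move=> y; rewrite inE => y1; exact/esym/radial_partial.
  apply: continuous_in_subspaceT => x; rewrite inE => x1.
  by apply: continuousM; [apply: continuous_comp_enorm; exact: cw|exact: cc].
split; first split.
- apply: (@subspace_eq_continuous _ _ _ (fun y => f (enorm y))).
    by move=> y; rewrite inE => y1; exact/esym/uf.
  apply: continuous_in_subspaceT => x; rewrite inE => x1.
  by apply: continuous_comp_enorm; exact: cf.
- move=> i; split=> // x x1; by have [] := radial_is_derive i x1.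
- move=> i; split=> // j; split=> [x x1|].
    by have [] := radial_is_derive2 i j x1.
  apply: (@subspace_eq_continuous _ _ _ (fun x => w1 (enorm x) / enorm x *
      (x 0 i * x 0 j) + w (enorm x) * (i == j)%:R)).
    move=> x; rewrite inE => x1; have [_] := radial_is_derive2 i j x1.
    by rewrite mulr_natr => H; exact: esym H.
  apply: continuous_in_subspaceT => x; rewrite inE => x1.
  have x0 : enorm x != 0 by rewrite gt_eqF // (lt_trans ltr01).
  apply: (@continuousD _ _ _ (fun x => w1 (enorm x) / enorm x *
      (x 0 i * x 0 j)) (fun x => w (enorm x) * (i == j)%:R)).
    apply: continuousM; last by apply: continuousM; exact: cc.
    apply: continuousM; first by apply: continuous_comp_enorm; exact: w1c.
    by apply: continuousV => //; exact: enorm_continuous.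
  by apply: continuousM; [apply: continuous_comp_enorm; exact: cw|exact: cst_continuous].
Qed.

End Radial.

(** The gradient extends to the sphere as w(|x|) x. Only continuity of [w] is asked at r = 1, since
    [w] may fail to be differentiable there at the extreme parameter. *)
Lemma radial_C1_ext_closed (f w : R -> R) :
  (forall r : R, 1 <= r -> is_derive r 1 f (r * w r)) ->
  (forall r : R, 1 <= r -> {for r, continuous w}) ->
  C1_ext_closed (fun x : 'rV[R]_n => f (enorm x)).
Proof.
move=> fw cw; have cf r : 1 <= r -> {for r, continuous f}.
  by move=> r1; have [df _] := fw r r1; apply/differentiable_continuous/derivable1_diffP.
have cc i : continuous (fun y : 'rV[R]_n => y 0 i) by exact: coord_continuous.
have fw' (r : R) : 1 < r -> is_derive r 1 f (r * w r) by move=> /ltW; exact: fw.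
have uf (x : 'rV[R]_n) : ext_open x -> f (enorm x) = f (enorm x) by [].
have cp i : {in @ext_closed R n,
    continuous (fun y : 'rV[R]_n => w (enorm y) * y 0 i)}.
  move=> x; rewrite inE => x1.
  by apply: continuousM; [apply: continuous_comp_enorm; exact: cw|exact: cc].
have oc : {subset @ext_open R n <= @ext_closed R n}.
  by move=> x; rewrite !inE => /ltW.
have cu : {in @ext_closed R n, continuous (fun y : 'rV[R]_n => f (enorm y))}.
  by move=> x; rewrite inE => x1; apply: continuous_comp_enorm; exact: cf.
split.
- exact: continuous_in_subspaceT.
- split; first by apply: continuous_in_subspaceT => x /oc /cu.
  move=> i; split=> [x x1|]; first by have [] := radial_is_derive uf fw' i x1.
  apply: (@subspace_eq_continuous _ _ _ (fun y => w (enorm y) * y 0 i)).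
    by move=> y; rewrite inE => y1; exact: (esym (radial_partial uf fw' i y1)).
  by apply: continuous_in_subspaceT => x /oc /cp.
- move=> i; exists (fun y => w (enorm y) * y 0 i); split.
    exact: continuous_in_subspaceT.
  by move=> x x1; rewrite (radial_partial uf fw').
Qed.

Lemma is_derive_ray u i (r : R) : derivable u (r *: delta_mx 0 i) (delta_mx 0 i) ->
  is_derive r 1 (fun t : R => u (t *: delta_mx 0 i))
    (partial i u (r *: delta_mx 0 i)).
Proof.
move=> /derivableP /is_derive_lineP D; apply/is_derive_lineP.
rewrite (_ : (fun h => _) =
  (fun h : R => u (h *: delta_mx 0 i + r *: delta_mx 0 i))) //.
by apply/funext => h; rewrite -scalerDl [h%:A]mulr1.
Qed.

(** Links the boundary values to the profile on r > 1. As [u] is controlled only outside the ball,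
    the limit is one-sided. *)
Lemma ray_cvg1 u i : {within @ext_closed R n, continuous u} ->
  u (t *: delta_mx 0 i) @[t --> 1^'+] --> u (1 *: delta_mx 0 i).
Proof.
move=> /subspace_continuousP /(_ (1 *: delta_mx 0 i)).
have /[swap]/[apply] : ext_closed (1 *: delta_mx 0 i : 'rV[R]_n).
  by rewrite /ext_closed /= enorm_delta.
apply: cvg_trans => A /= NA.
have : (fun t : R => t *: (delta_mx 0 i : 'rV[R]_n)) @ (1:R)^'+ -->
   (1 *: delta_mx 0 i : 'rV[R]_n).
  apply: cvg_at_right_filter; apply: cvgZr_tmp; exact: cvg_id.
move=> /(_ _ NA) /= H.
have H' : \forall t \near (1:R)^'+, ext_closed (t *: (delta_mx 0 i : 'rV[R]_n)) ->
  A (u (t *: delta_mx 0 i)) by exact: H.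
have H1 : \forall t \near (1:R)^'+, 1 < t by exact: nbhs_right_gt.
change (\forall t \near (1:R)^'+, A (u (t *: delta_mx 0 i))).
apply: filterS2 H' H1 => t /= tb t1; apply: tb.
by rewrite /ext_closed /= enorm_delta ltW // (lt_trans ltr01).
Qed.

End RadialFunctions.

(** * The first integral and its inverse *)

Lemma is_derive_continuous (R : realType) (f : R -> R) (x d : R) :
  is_derive x 1 f d -> {for x, continuous f}.
Proof. by case=> df _; apply/differentiable_continuous/derivable1_diffP. Qed.

Lemma is_derive_itv_continuous (R : realType) (f f' : R -> R) (x y : R) :
  (forall t, x <= t <= y -> is_derive t 1 f (f' t)) ->
  {within `[x, y], continuous f}.
Proof.
move=> df; apply: continuous_in_subspaceT => t; rewrite inE /= in_itv /=.
by move=> /df; exact: is_derive_continuous.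
Qed.

(** A comparison of integrals expressed through primitives, by the mean value theorem for [g - f];
    later estimates then compare derivatives and need no integrability argument. *)
Lemma le_increment (R : realType) (f g f' g' : R -> R) (x y : R) : x <= y ->
  (forall t, x <= t <= y -> is_derive t 1 f (f' t)) ->
  (forall t, x <= t <= y -> is_derive t 1 g (g' t)) ->
  (forall t, x <= t <= y -> f' t <= g' t) ->
  f y - f x <= g y - g x.
Proof.
move=> xy df dg fg.
have dh t : x <= t <= y -> is_derive t 1 (g - f) (g' t - f' t).
  by move=> xty; apply: is_deriveB; [exact: dg|exact: df].
have [t|t tin E] := @MVT_segment _ (g - f) (fun t => g' t - f' t) _ _ xy _
    (is_derive_itv_continuous dh).
  by rewrite in_itv /= => /andP[/ltW xt /ltW ty]; apply: dh; rewrite xt ty.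
have : 0 <= (g' t - f' t) * (y - x).
  by rewrite mulr_ge0 ?subr_ge0 //; apply: fg; move: tin; rewrite in_itv.
by rewrite -E -![(_ - _) _]/(_ - _); lra.
Qed.

Lemma lt_increment (R : realType) (f g f' g' : R -> R) (x y : R) : x < y ->
  (forall t, x <= t <= y -> is_derive t 1 f (f' t)) ->
  (forall t, x <= t <= y -> is_derive t 1 g (g' t)) ->
  (forall t, x <= t <= y -> f' t < g' t) ->
  f y - f x < g y - g x.
Proof.
move=> xy df dg fg.
have dh t : x <= t <= y -> is_derive t 1 (g - f) (g' t - f' t).
  by move=> xty; apply: is_deriveB; [exact: dg|exact: df].
have [t|t tin E] := @MVT_segment _ (g - f) (fun t => g' t - f' t) _ _ (ltW xy) _
    (is_derive_itv_continuous dh).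
  by rewrite in_itv /= => /andP[/ltW xt /ltW ty]; apply: dh; rewrite xt ty.
have : 0 < (g' t - f' t) * (y - x).
  by rewrite mulr_gt0 ?subr_gt0 //; apply: fg; move: tin; rewrite in_itv.
by rewrite -E -![(_ - _) _]/(_ - _); lra.
Qed.

Lemma is_derive_pow (R : realType) (p : nat) (t : R) :
  is_derive t 1 (fun t : R => t ^+ p) (p%:R * t ^+ p.-1).
Proof.
constructor; first exact: exprn_derivable.
by rewrite exp_derive [LHS]mulr1.
Qed.

Lemma exprD_ge (R : realType) (p : nat) (x y : R) : 0 <= x -> 0 <= y ->
  (0 < p)%N -> x ^+ p + y ^+ p <= (x + y) ^+ p.
Proof.
move=> x0 y0; case: p => // p _; elim: p => [|p IH]; first by rewrite !expr1.
have H1 : x ^+ p.+2 <= x * (x + y) ^+ p.+1.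
  by rewrite exprS ler_wpM2l // lerXn2r // ?nnegrE ?addr_ge0 // lerDl.
have H2 : y ^+ p.+2 <= y * (x + y) ^+ p.+1.
  by rewrite exprS ler_wpM2l // lerXn2r // ?nnegrE ?addr_ge0 // lerDr.
by rewrite [(x + y) ^+ _]exprS mulrDl lerD.
Qed.

Lemma exprz_2sub (R : realType) (n : nat) (x : R) : (2 < n)%N ->
  x ^ (2%:Z - n%:Z) = (x ^+ (n - 2))^-1.
Proof.
by move=> n2; rewrite exprnN; congr (_ ^ _); lia.
Qed.

Section Flux.
Context {R : realType}.
Variables (k l : nat) (ck cl U0 a : R).
Hypotheses (lk : (l < k)%N) (ck0 : 0 < ck) (cl0 : 0 < cl).
Hypotheses (U00 : 0 <= U0) (U0E : k%:R * ck * U0 ^+ (k - l) = l%:R * cl).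
Hypotheses (a0 : 0 < a) (aE : ck * a ^+ (k - l) = cl).

(** The function F of the overview. [U0], where the inverted branch starts, and [a], its positive
    zero, enter only through the polynomial identities [U0E] and [aE], which keeps real powers out
    of the analysis. *)
Definition flux (y : R) := ck * y ^+ k - cl * y ^+ l.
Definition dflux (y : R) := ck * (k%:R * y ^+ k.-1) - cl * (l%:R * y ^+ l.-1).

Let kl0 : (0 < k - l)%N. Proof. by rewrite subn_gt0. Qed.
Let k0 : (0 < k)%N. Proof. exact: leq_ltn_trans lk. Qed.

Lemma is_derive_flux (y : R) : is_derive y 1 flux (dflux y).
Proof.
have D := is_deriveB (is_deriveZ ck (is_derive_pow k y))
  (is_deriveZ cl (is_derive_pow l y)).
exact: D.
Qed.

Lemma flux_continuous : continuous flux.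
Proof. by move=> y; exact: is_derive_continuous (is_derive_flux y). Qed.

(** By [U0E] the derivative factors as k ck (y+s)^(l-1) ((y+s)^(k-l) - U0^(k-l)), and (y+s)^(k-l) >=
    y^(k-l) + s^(k-l) with y >= U0. The case l = 0 is separate because of the truncated [l.-1]. *)
Lemma dflux_ge y s : U0 <= y -> 0 <= s -> ck * (k%:R * s ^+ k.-1) <= dflux (y + s).
Proof.
move=> Uy s0; rewrite /dflux; have y0 := le_trans U00 Uy.
have [l0|l1] := posnP l.
  rewrite l0 mul0r mulr0 subr0 ler_pM2l // ler_wpM2l // lerXn2r //.
    by rewrite nnegrE addr_ge0.
  by rewrite lerDr.
have -> : k.-1 = (l.-1 + (k - l))%N by lia.
rewrite !exprD.
have H1 : s ^+ l.-1 <= (y + s) ^+ l.-1.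
  by rewrite lerXn2r ?nnegrE ?addr_ge0 // lerDr.
have H2 : s ^+ (k - l) <= (y + s) ^+ (k - l) - U0 ^+ (k - l).
  rewrite lerBrDl (le_trans _ (exprD_ge y0 s0 kl0)) // lerD2r.
  by rewrite lerXn2r ?nnegrE.
have -> : ck * (k%:R * ((y + s) ^+ l.-1 * (y + s) ^+ (k - l))) -
    cl * (l%:R * (y + s) ^+ l.-1) =
    ck * (k%:R * ((y + s) ^+ l.-1 * ((y + s) ^+ (k - l) - U0 ^+ (k - l)))).
  have -> : cl * (l%:R * (y + s) ^+ l.-1) =
    k%:R * ck * U0 ^+ (k - l) * (y + s) ^+ l.-1 by rewrite U0E; ring.
  ring.
rewrite ler_pM2l // ler_wpM2l // ler_pM // exprn_ge0 //.
Qed.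

(* Stronger than monotonicity, and uniform up to [U0], where [dflux] vanishes:
   it makes the inverse of [flux] Hoelder continuous there. *)
Lemma flux_superadd y t : U0 <= y -> 0 <= t -> flux y + ck * t ^+ k <= flux (y + t).
Proof.
move=> Uy t0.
have D1 (s : R) : 0 <= s <= t ->
    is_derive s 1 (fun s => ck * s ^+ k) (ck * (k%:R * s ^+ k.-1)).
  by move=> _; exact: (is_deriveZ ck (is_derive_pow k s)).
have D2 (s : R) : 0 <= s <= t -> is_derive s 1 (fun s : R => flux (y + s)) (dflux (y + s)).
  move=> _; have D : is_derive s (1 : R) (fun s : R => y + s) 1.
    have := is_deriveD (is_derive_cst y s (1 : R)) (is_derive_id s (1 : R)).
    by rewrite add0r.
  rewrite -[dflux _]mulr1; exact: (is_derive1_comp (is_derive_flux (y + s)) D).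
have := le_increment t0 D1 D2 _; rewrite addr0 expr0n eqn0Ngt k0 mulr0 subr0.
by rewrite lerBrDl; apply => s /andP[s0 _]; exact: dflux_ge.
Qed.

Lemma flux_lt y z : U0 <= y -> y < z -> flux y < flux z.
Proof.
move=> Uy yz; have := @flux_superadd y (z - y) Uy.
rewrite subr_ge0 => /(_ (ltW yz)); rewrite [y + _]addrC subrK.
by apply: lt_le_trans; rewrite ltrDl mulr_gt0 // exprn_gt0 // subr_gt0.
Qed.

Lemma flux_inj y z : U0 <= y -> U0 <= z -> flux y = flux z -> y = z.
Proof.
move=> Uy Uz E; case: (ltgtP y z) => // yz.
  by have := flux_lt Uy yz; rewrite E ltxx.
by have := flux_lt Uz yz; rewrite E ltxx.
Qed.

Lemma flux_le y z : U0 <= y -> U0 <= z -> (flux y <= flux z) = (y <= z).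
Proof.
move=> Uy Uz; case: (ltgtP y z) => [yz|yz|->]; last by rewrite lexx.
  by rewrite ltW // flux_lt.
by apply/negbTE; rewrite -ltNge flux_lt.
Qed.

Lemma dflux_gt0 y : U0 < y -> 0 < dflux y.
Proof.
move=> Uy; have y0 := le_lt_trans U00 Uy; rewrite /dflux.
have kR : 0 < k%:R :> R by rewrite ltr0n.
have [l0|l1] := posnP l.
  by rewrite l0 mul0r mulr0 subr0 !mulr_gt0 // exprn_gt0.
have -> : k.-1 = (l.-1 + (k - l))%N by lia.
rewrite exprD; have H : U0 ^+ (k - l) < y ^+ (k - l).
  by rewrite ltrXn2r ?nnegrE ?(ltW y0) // -lt0n.
have -> : ck * (k%:R * (y ^+ l.-1 * y ^+ (k - l))) - cl * (l%:R * y ^+ l.-1) =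
    ck * (k%:R * (y ^+ l.-1 * (y ^+ (k - l) - U0 ^+ (k - l)))).
  have -> : cl * (l%:R * y ^+ l.-1) =
    k%:R * ck * U0 ^+ (k - l) * y ^+ l.-1 by rewrite U0E; ring.
  ring.
by rewrite !mulr_gt0 // ?subr_gt0 // exprn_gt0.
Qed.

Lemma fluxE y : flux y = y ^+ l * (ck * y ^+ (k - l) - cl).
Proof. by rewrite /flux -{1}(subnKC (ltnW lk)) exprD; ring. Qed.

Lemma flux_a : flux a = 0.
Proof. by rewrite fluxE aE subrr mulr0. Qed.

Lemma U0l_gt0 : 0 < U0 ^+ l.
Proof.
have [->|l1] := posnP l; first by rewrite expr0.
rewrite exprn_gt0 // lt_neqAle U00 andbT eq_sym; apply/eqP => U0_0.
move: U0E; rewrite U0_0 expr0n eqn0Ngt kl0 mulr0 => /eqP.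
by rewrite eq_sym mulf_eq0 pnatr_eq0 eqn0Ngt l1 gt_eqF.
Qed.

Lemma U0_lt_a : U0 < a.
Proof.
have : k%:R * ck * U0 ^+ (k - l) < k%:R * ck * a ^+ (k - l).
  by rewrite U0E -mulrA aE ltr_pM2r // ltr_nat.
by rewrite ltr_pM2l ?mulr_gt0 ?ltr0n // ltr_pXn2r ?nnegrE // ltW.
Qed.

Lemma flux_U0_lt0 : flux U0 < 0.
Proof. by rewrite -flux_a flux_lt // U0_lt_a. Qed.

Lemma flux_surj z : flux U0 <= z -> exists y, U0 <= y /\ flux y = z.
Proof.
(* As T >= 1, ck T^k >= ck T >= z - flux U0, so superadditivity puts flux (U0 + T) above z. *)
move=> Uz; pose T := 1 + (z - flux U0) / ck.
have T1 : 1 <= T by rewrite lerDl divr_ge0 ?subr_ge0 // ltW.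
have T0 := le_trans ler01 T1.
have zT : z <= flux (U0 + T).
  apply: le_trans (flux_superadd (lexx U0) T0); rewrite -lerBlDl.
  apply: (@le_trans _ _ (ck * T)).
    by rewrite mulrDr mulr1 mulrCA divff ?gt_eqF // mulr1 lerDr ltW.
  by rewrite ler_pM2l // ler_eXnr.
have UT : U0 <= U0 + T by rewrite lerDl.
have cf : {within `[U0, U0 + T], continuous flux}.
  by apply: continuous_subspaceT; exact: flux_continuous.
have [|y] := @IVT _ flux U0 (U0 + T) z UT cf.
  by rewrite ge_min Uz /= le_max zT orbT.
by rewrite in_itv /= => /andP[Uy _] <-; exists y.
Qed.

(* Extended by the constant [U0] below [flux U0], so as to be continuous
   on the whole line. *)
Definition flux_inv (z : R) : R := xget U0 [set y | U0 <= y /\ flux y = z].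

Lemma flux_inv_ge z : U0 <= flux_inv z.
Proof. by rewrite /flux_inv; case: xgetP => [y _ []|]. Qed.

Lemma flux_invK z : flux U0 <= z -> flux (flux_inv z) = z.
Proof.
move=> /flux_surj[y [Uy yz]]; rewrite /flux_inv.
by case: xgetP => [x _ [] //|/(_ y)]; case.
Qed.

Lemma flux_inv_below z : z <= flux U0 -> flux_inv z = U0.
Proof.
move=> zU; rewrite /flux_inv; case: xgetP => // x _ [Ux xz].
by apply/eqP; rewrite eq_le Ux andbT -flux_le // xz.
Qed.

Lemma fluxK y : U0 <= y -> flux_inv (flux y) = y.
Proof.
move=> Uy; apply: flux_inj => //; first exact: flux_inv_ge.
by rewrite flux_invK // flux_le.
Qed.

Lemma flux_inv_0 : flux_inv 0 = a.
Proof. by rewrite -flux_a fluxK // ltW // U0_lt_a. Qed.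

Lemma flux_inv_lt z z' : flux U0 <= z -> z < z' -> flux_inv z < flux_inv z'.
Proof.
move=> Uz zz'; rewrite ltNge -flux_le ?flux_inv_ge // !flux_invK -?ltNge //.
exact: le_trans (ltW zz').
Qed.

Lemma flux_inv_le z z' : z <= z' -> flux_inv z <= flux_inv z'.
Proof.
move=> zz'; have [zU|Uz] := leP z (flux U0).
  by rewrite flux_inv_below // flux_inv_ge.
rewrite -flux_le ?flux_inv_ge // !flux_invK //; last exact: ltW.
by rewrite (le_trans _ zz') // ltW.
Qed.

Lemma flux_inv_holder z z' : z <= z' ->
  ck * (flux_inv z' - flux_inv z) ^+ k <= z' - z.
Proof.
have main x x' : flux U0 <= x -> x <= x' ->
    ck * (flux_inv x' - flux_inv x) ^+ k <= x' - x.
  move=> Ux xx'; have Ux' := le_trans Ux xx'.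
  have := @flux_superadd (flux_inv x) (flux_inv x' - flux_inv x) (flux_inv_ge x).
  rewrite subr_ge0 flux_inv_le // => /(_ isT).
  by rewrite [_ + (_ - _)]addrC subrK !flux_invK // lerBrDl.
move=> zz'; have [zU|/ltW] := leP z (flux U0); last by move=> ?; exact: main.
have [z'U|Uz'] := leP z' (flux U0).
  by rewrite !flux_inv_below // subrr expr0n eqn0Ngt k0 mulr0 subr_ge0.
rewrite (flux_inv_below zU) -{1}(flux_inv_below (lexx (flux U0))).
by apply: le_trans (main _ _ (lexx _) (ltW Uz')) _; rewrite lerD2l lerN2.
Qed.

(** Since [d] does not depend on the point, one change of the parameter controls the whole profile
    at once; continuity of [nu] rests on this. *)
Lemma flux_inv_unif e : 0 < e -> exists2 d, 0 < d &
  forall z z', `|z - z'| < d -> `|flux_inv z - flux_inv z'| < e.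
Proof.
move=> e0; exists (ck * e ^+ k); first by rewrite mulr_gt0 // exprn_gt0.
have main z z' : z <= z' -> z' - z < ck * e ^+ k -> flux_inv z' - flux_inv z < e.
  move=> zz' zd; have := le_lt_trans (flux_inv_holder zz') zd.
  by rewrite ltr_pM2l // ltr_pXn2r ?nnegrE ?subr_ge0 ?flux_inv_le // ltW.
move=> z z'; have [zz'|/ltW zz'] := leP z z'.
  by rewrite distrC ger0_norm ?subr_ge0 // distrC ger0_norm ?subr_ge0
    ?flux_inv_le //; exact: main.
by rewrite ger0_norm ?subr_ge0 // ger0_norm ?subr_ge0 ?flux_inv_le //; exact: main.
Qed.

Lemma flux_inv_continuous : continuous flux_inv.
Proof.
move=> z; apply/cvgrPdist_lt => e /flux_inv_unif[d d0 H].
by exists d => //= t; exact: H.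
Qed.

Lemma is_derive_flux_inv (z : R) : flux U0 < z ->
  is_derive z 1 flux_inv (dflux (flux_inv z))^-1.
Proof.
move=> Uz; have Ug : U0 < flux_inv z.
  by rewrite -(fluxK (lexx U0)) flux_inv_lt.
have {1}-> : z = flux (flux_inv z) by rewrite flux_invK // ltW.
apply: is_derive_inverse; last by rewrite gt_eqF // dflux_gt0.
- near=> y; apply: fluxK; apply: ltW; near: y.
  exact: lt_nbhsr.
- by near=> y; exact: flux_continuous.
- exact: is_derive_flux.
Unshelve. all: by end_near. Qed.

(** In flux y = ck y^l (y^(k-l) - a^(k-l)) the factor y - a splits off, and the remaining factors
    are bounded below on y >= U0. This linear bound is the source of the decay rate at infinity. *)
Lemma flux_inv_lin z : flux U0 <= z ->
  `|flux_inv z - a| <= (ck * U0 ^+ l * a ^+ (k - l).-1)^-1 * `|z|.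
Proof.
move=> Uz; set y := flux_inv z; have Uy : U0 <= y := flux_inv_ge z.
have y0 := le_trans U00 Uy.
rewrite ler_pdivlMl; last by rewrite mulr_gt0 ?exprn_gt0 // mulr_gt0 // U0l_gt0.
rewrite -{1}(flux_invK Uz) -/y fluxE -aE -mulrBr subrXX !normrM.
rewrite [`|ck|]gtr0_norm // [`|y ^+ l|]ger0_norm ?exprn_ge0 //.
(* All terms are nonnegative, and the last one, i = k - l - 1, equals a^(k-l-1) whatever y is. *)
have S : a ^+ (k - l).-1 <=
    `|\sum_(i < k - l) y ^+ ((k - l).-1 - i) * a ^+ i|.
  have T j i : 0 <= y ^+ j * a ^+ i.
    by rewrite mulr_ge0 ?exprn_ge0 // ltW.
  rewrite ger0_norm ?sumr_ge0 //.
  have ltkl : ((k - l).-1 < k - l)%N by rewrite prednK.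
  rewrite (bigD1 (Ordinal ltkl)) //= subnn expr0 mul1r lerDl.
  by rewrite sumr_ge0 // => i _; exact: T.
have -> : y ^+ l * (ck * (`|y - a| * `|\sum_(i < k - l) y ^+ ((k - l).-1 - i) * a ^+ i|))
  = ck * y ^+ l * `|\sum_(i < k - l) y ^+ ((k - l).-1 - i) * a ^+ i| * `|y - a| by ring.
rewrite ler_wpM2r // ler_pM ?exprn_ge0 // ?mulr_ge0 ?(ltW ck0) ?(ltW U0l_gt0) ?(ltW a0) //.
by rewrite ler_pM2l // lerXn2r ?nnegrE.
Qed.

(** * The one-parameter family of radial profiles *)

Section Profile.
Variable n : nat.
Hypothesis n2 : (2 < n)%N.
Local Notation G := flux_inv.
Local Notation mu := (@lebesgue_measure R).

(* The cut-off at [s = 1] makes [phi] continuous on the whole line. *)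
Definition phi (al s : R) := Num.max s 1 * (G (al / Num.max s 1 ^+ n) - a).
(** The base point 0 lies to the left of 1, so that [Phi] has a two-sided derivative at 1;
    differences [Phi al x - Phi al 1] remove the extra constant. *)
Definition Phi (al x : R) := Rintegral mu `[0, x] (phi al).
Definition nu (al : R) := Rintegral mu `]1, +oo[ (phi al).
Definition lin_const := (ck * U0 ^+ l * a ^+ (k - l).-1)^-1.

Lemma lin_const_ge0 : 0 <= lin_const.
Proof. by rewrite invr_ge0 !mulr_ge0 ?exprn_ge0 // ltW. Qed.

Lemma phiE al s : 1 <= s -> phi al s = s * (G (al / s ^+ n) - a).
Proof. by move=> s1; rewrite /phi max_l. Qed.

Lemma phi_continuous al : continuous (phi al).
Proof.
have cm : continuous (fun s : R => Num.max s 1).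
  by move=> s; apply: (@continuous_max _ _ id (cst 1)) => //; exact: cst_continuous.
move=> s; rewrite /continuous_at /phi; apply: cvgM; first exact: cm.
apply: cvgB; last exact: cvg_cst.
apply: (@continuous_cvg _ _ _ _ _ _ G); first exact: flux_inv_continuous.
apply: cvgM; first exact: cvg_cst.
apply: cvgV.
  by rewrite gt_eqF // exprn_gt0 // (lt_le_trans ltr01) // le_max lexx orbT.
apply: (@continuous_cvg _ _ _ _ _ _ (fun t : R => t ^+ n)); last exact: cm.
exact: exprn_continuous.
Qed.

Lemma is_derive_Phi (al x : R) : 0 < x -> is_derive x 1 (Phi al) (phi al x).
Proof.
move=> x0; have xx : x < x + 1 by rewrite ltrDl.
have [|//||D1 D2] := @continuous_FTC1_closed R (phi al) 0 x (x + 1) xx.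
- apply: continuous_compact_integrable; first exact: segment_compact.
  by apply: continuous_subspaceT; exact: phi_continuous.
- exact: phi_continuous.
by constructor; [exact: D1|rewrite -derive1E; exact: D2].
Qed.

Lemma arg_ge al s : flux U0 <= al -> 1 <= s -> flux U0 <= al / s ^+ n.
Proof.
move=> Ual s1; have s0 : 0 < s ^+ n by rewrite exprn_gt0 // (lt_le_trans ltr01).
rewrite ler_pdivlMr //; apply: le_trans Ual.
by rewrite ler_neMr ?exprn_ege1 // ltW // flux_U0_lt0.
Qed.

(** Dividing the negative number flux U0 by s^n > 1 raises it strictly. Hence even the endpoint al =
    flux U0 stays in the open range where [flux_inv] is differentiable. *)
Lemma arg_gt al s : flux U0 <= al -> 1 < s -> flux U0 < al / s ^+ n.
Proof.
move=> Ual s1; have s0 : 0 < s ^+ n by rewrite exprn_gt0 // (lt_trans ltr01).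
rewrite ltr_pdivlMr //; apply: lt_le_trans Ual.
rewrite -[ltRHS]mulr1 ltr_nM2l ?flux_U0_lt0 //.
by rewrite exprn_egt1 // -lt0n (ltn_trans _ n2).
Qed.

Lemma phi_ge0 al s : 0 <= al -> 0 <= phi al s.
Proof.
move=> al0; have m0 : 0 <= Num.max s 1 :> R by rewrite le_max ler01 orbT.
by rewrite mulr_ge0 // subr_ge0 -flux_inv_0 flux_inv_le // divr_ge0 // exprn_ge0.
Qed.

Lemma phi_le0 al s : al <= 0 -> phi al s <= 0.
Proof.
move=> al0; have m0 : 0 <= Num.max s 1 :> R by rewrite le_max ler01 orbT.
rewrite mulr_ge0_le0 // subr_le0 -flux_inv_0 flux_inv_le //.
by rewrite mulr_le0_ge0 // invr_ge0 exprn_ge0.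
Qed.

Lemma phi_bound al s : flux U0 <= al -> 1 <= s ->
  `|phi al s| <= lin_const * `|al| / s ^+ n.-1.
Proof.
move=> Ual s1; have s0 := lt_le_trans ltr01 s1.
rewrite phiE // normrM gtr0_norm //.
have := flux_inv_lin (arg_ge Ual s1); rewrite -/lin_const => /(ler_wpM2l (ltW s0)).
move=> /le_trans; apply; rewrite normrM normfV [`|s ^+ n|]gtr0_norm ?exprn_gt0 //.
have -> : s ^+ n = s * s ^+ n.-1 by rewrite -exprS prednK // (ltn_trans _ n2).
have : s ^+ n.-1 != 0 by rewrite gt_eqF // exprn_gt0.
move: (s ^+ n.-1) lin_const `|al| => t c z t0.
suff -> : s * (c * (z / (s * t))) = c * z / t by [].
by field; rewrite t0 gt_eqF.
Qed.

Lemma Phi_bound al x y : flux U0 <= al -> 1 <= x -> x <= y ->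
  `|Phi al y - Phi al x| <= lin_const * `|al| / x ^+ (n - 2).
Proof.
move=> Ual x1 xy; set C := lin_const * `|al|.
have C0 : 0 <= C by rewrite mulr_ge0 // lin_const_ge0.
have x0 := lt_le_trans ltr01 x1.
(* The derivative of [g] carries the factor n - 2 >= 1, so it dominates the bound C / t^(n-1) on
   [phi] without a division by n - 2. *)
pose g (t : R) := - C * (t ^+ (n - 2))^-1.
pose g' (t : R) := C * ((n - 2)%:R / t ^+ n.-1).
have dg (t : R) : x <= t <= y -> is_derive t 1 g (g' t).
  move=> /andP[xt _]; have t0 := lt_le_trans x0 xt.
  have tn0 : t ^+ (n - 2) != 0 by rewrite gt_eqF // exprn_gt0.
  have D : is_derive t 1 g _ :=
    is_deriveZ (- C) (@is_deriveV _ (fun t : R => t ^+ (n - 2)) t _ 1 tn0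
      (is_derive_pow (n - 2) t)).
  apply: (is_derive_eq D).
  rewrite /g' /GRing.scale /=; case: (n) n2 => [|[|[|q]]] // _.
  rewrite !subSS subn0 /= !exprS; have : t ^+ q != 0 by rewrite gt_eqF // exprn_gt0.
  by move: (t ^+ q) => z z0; field; rewrite z0 gt_eqF.
have dP (t : R) : x <= t <= y -> is_derive t 1 (Phi al) (phi al t).
  by move=> /andP[xt _]; exact: is_derive_Phi (lt_le_trans x0 xt).
have B t : x <= t <= y -> `|phi al t| <= g' t.
  move=> /andP[xt _]; have t1 := le_trans x1 xt.
  apply: le_trans (phi_bound Ual t1) _; rewrite /g' -/C ler_wpM2l //.
  have tn : 0 < t ^+ n.-1 by rewrite exprn_gt0 // (lt_le_trans x0).
  by rewrite ler_pdivlMr // mulVf ?gt_eqF // ler1n subn_gt0.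
have gxy : g y - g x <= C / x ^+ (n - 2).
  rewrite /g !mulNr opprK addrC lerBlDr lerDl.
  by rewrite mulr_ge0 // invr_ge0 exprn_ge0 // ltW // (lt_le_trans x0).
apply: le_trans gxy; rewrite ler_norml; apply/andP; split.
  have dN (t : R) : x <= t <= y -> is_derive t 1 (- g) (- g' t).
    by move=> xty; exact: is_deriveN (dg t xty).
  have := le_increment xy dN dP _; rewrite -![(- g) _]/(- g _).
  rewrite opprB opprK [- g y + _]addrC; apply => t xty.
  by have := B t xty; rewrite ler_norml => /andP[].
apply: (le_increment xy dP dg) => t xty.
by have := B t xty; rewrite ler_norml => /andP[].
Qed.

Lemma Phi_mono al x y : 0 <= al -> 0 < x -> x <= y -> Phi al x <= Phi al y.
Proof.
move=> al0 x0 xy.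
have d0 (t : R) : x <= t <= y -> is_derive t 1 (cst (0 : R)) 0.
  by move=> _; exact: is_derive_cst.
have dP (t : R) : x <= t <= y -> is_derive t 1 (Phi al) (phi al t).
  by move=> /andP[xt _]; exact: is_derive_Phi (lt_le_trans x0 xt).
have := le_increment xy d0 dP (fun t _ => phi_ge0 t al0).
by rewrite subrr subr_ge0.
Qed.

Lemma Phi_anti al x y : al <= 0 -> 0 < x -> x <= y -> Phi al y <= Phi al x.
Proof.
move=> al0 x0 xy.
have d0 (t : R) : x <= t <= y -> is_derive t 1 (cst (0 : R)) 0.
  by move=> _; exact: is_derive_cst.
have dP (t : R) : x <= t <= y -> is_derive t 1 (Phi al) (phi al t).
  by move=> /andP[xt _]; exact: is_derive_Phi (lt_le_trans x0 xt).
have := le_increment xy dP d0 (fun t _ => phi_le0 t al0).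
by rewrite subrr subr_le0.
Qed.

Lemma Phi_is_cvg al : flux U0 <= al -> exists L : R, Phi al x @[x --> +oo] --> L.
Proof.
move=> Ual; pose C := lin_const * `|al|.
have B y : 1 <= y -> `|Phi al y - Phi al 1| <= C.
  by move=> y1; have := Phi_bound Ual (lexx 1) y1; rewrite expr1n divr1.
have m1 (x : R) : 1 <= Num.max x 1 by rewrite le_max lexx orbT.
(* Composing with max x 1 makes [Phi] monotone and bounded on the whole line without changing its
   limit at infinity. *)
have near_max (h : R -> R) (L : R) :
    h (Num.max x 1) @[x --> +oo] --> L -> h x @[x --> +oo] --> L.
  apply: cvg_trans; apply: near_eq_cvg; exists 1; split=> [|x /ltW x1].
    exact: num_real.
  by rewrite /= max_l.
have [al0|/ltW al0] := leP 0 al.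
  have ndf : nondecreasing_fun (fun x : R => Phi al (Num.max x 1)).
    move=> x y xy; apply: Phi_mono => //; first exact: lt_le_trans (m1 x).
    by rewrite ge_max !le_max xy lexx !orbT.
  have /(nondecreasing_cvgr ndf) : has_ubound
      (range (fun x : R => Phi al (Num.max x 1))).
    exists (Phi al 1 + C) => _ [x _ <-]; rewrite -lerBlDl.
    exact: le_trans (ler_norm _) (B _ (m1 x)).
  by move=> /near_max PL; eexists; exact: PL.
have ndf : nondecreasing_fun (fun x : R => - Phi al (Num.max x 1)).
  move=> x y xy; rewrite lerN2; apply: Phi_anti => //.
    exact: lt_le_trans (m1 x).
  by rewrite ge_max !le_max xy lexx !orbT.
have /(nondecreasing_cvgr ndf) : has_ubound
    (range (fun x : R => - Phi al (Num.max x 1))).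
  exists (C - Phi al 1) => _ [x _ <-]; rewrite -lerBlDr opprK addrC.
  by apply: le_trans (B _ (m1 x)); rewrite distrC ler_norm.
set L := sup _ => /(near_max (fun x => - Phi al x) L) /cvgN PL.
exists (- L).
rewrite (_ : Phi al = - (fun x => - Phi al x)); first exact: PL.
by apply/funext => x; rewrite -[RHS]/(- - Phi al x) opprK.
Qed.

(** The factor [d] is carried along because the integrand of [mu_] will be [a^-1 * phi al s]. *)
Lemma Rintegral_phi (d al L : R) : 0 <= d -> Phi al x @[x --> +oo] --> L ->
  Rintegral mu `]1, +oo[ (fun s => d * phi al s) = d * (L - Phi al 1).
Proof.
move=> d0 PL; pose F (x : R) := d * Phi al x.
have cphi : continuous (fun s => d * phi al s).
  by move=> s; apply: cvgM; [exact: cvg_cst|exact: phi_continuous].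
have mphi := continuous_measurable_fun cphi.
have -> : Rintegral mu `]1, +oo[ (fun s => d * phi al s) =
    Rintegral mu `[1, +oo[ (fun s => d * phi al s).
  rewrite /Rintegral integral_itv_obnd_cbnd //.
  by apply/measurable_EFinP; exact: measurable_funTS.
have dF (x : R) : 0 < x -> is_derive x 1 F (d * phi al x).
  move=> x0; have D : is_derive x 1 F _ := is_deriveZ d (is_derive_Phi al x0).
  exact: D.
have dF1 (x : R) : 1 < x -> derivable F x 1.
  by move=> x1; have [] := dF x (lt_trans ltr01 x1).
have dFE : {in `]1, +oo[, derive1 F =1 (fun s => d * phi al s)}.
  move=> x; rewrite in_itv /= andbT => x1; rewrite derive1E.
  by have [] := dF x (lt_trans ltr01 x1).
have F1 : F x @[x --> (1:R)^'+] --> F 1.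
  by apply: cvg_at_right_filter; exact: is_derive_continuous (dF 1 ltr01).
have FL : F x @[x --> +oo] --> d * L by apply: cvgM => //; exact: cvg_cst.
have cw : {within `[1, +oo[, continuous (fun s => d * phi al s)}.
  exact: continuous_subspaceT.
(* [phi al] has the sign of [al], so the one-signed versions of the fundamental
   theorem of calculus on a half-line apply. *)
rewrite mulrBr -/(F 1); have [al0|/ltW al0] := leP 0 al.
  rewrite (@Rintegral_ge0_continuous_FTC2y _ _ F 1 (d * L)) //.
  by move=> x _; rewrite mulr_ge0 // phi_ge0.
rewrite /Rintegral (@le0_continuous_FTC2y _ _ F 1 (d * L)) //.
by move=> x _; rewrite mulr_ge0_le0 // phi_le0.
Qed.

Lemma Phi_cvg al : flux U0 <= al -> Phi al x @[x --> +oo] --> Phi al 1 + nu al.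
Proof.
move=> /Phi_is_cvg[L PL]; suff <- : L = Phi al 1 + nu al by [].
have := Rintegral_phi ler01 PL; rewrite mul1r.
have -> : (fun s => 1 * phi al s) = phi al by apply/funext => s; rewrite mul1r.
by rewrite -/(nu al) => ->; rewrite addrC subrK.
Qed.

(** * The constant at infinity as a function of the parameter *)

Lemma cvg_pinfty_ge (f : R -> R) (L x0 b : R) : f x @[x --> +oo] --> L ->
  (forall x, x0 <= x -> b <= f x) -> b <= L.
Proof.
move=> fL bf; apply/ler_addgt0Pr => e e0.
have /cvgrPdist_lt /(_ _ e0)[M [_ HM]] := fL.
pose x := Num.max x0 (M + 1).
have Mx : M < x by rewrite lt_max ltrDl ltr01 orbT.
have xx0 : x0 <= x by rewrite le_max lexx.
have /= := HM x Mx; rewrite ltr_norml => /andP[H _].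
have := bf x xx0; lra.
Qed.

Lemma nu_tail al x : flux U0 <= al -> 1 <= x ->
  `|Phi al x - Phi al 1 - nu al| <= lin_const * `|al| / x ^+ (n - 2).
Proof.
move=> Ual x1; set B := _ / _; have PL := Phi_cvg Ual.
have H y : x <= y -> `|Phi al y - Phi al x| <= B by exact: Phi_bound.
have H1 : Phi al x - B <= Phi al 1 + nu al.
  by apply: (cvg_pinfty_ge PL) => y /H; rewrite ler_norml => /andP[H1 _]; lra.
have H2 : - (Phi al x + B) <= - (Phi al 1 + nu al).
  by apply: (cvg_pinfty_ge (cvgN PL)) => y /H; rewrite ler_norml => /andP[_ H2];
    rewrite lerN2; lra.
by rewrite ler_norml; apply/andP; split; lra.
Qed.

(** A limit would lose strictness, so the strict gain is collected on [1, 2]; beyond 2 the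
    non-strict comparison suffices. *)
Lemma nu_lt al be : flux U0 <= al -> al < be -> nu al < nu be.
Proof.
move=> Ual albe; have Ube := le_trans Ual (ltW albe).
have dP ga (x y t : R) : 1 <= x -> x <= t <= y -> is_derive t 1 (Phi ga) (phi ga t).
  move=> x1 /andP[xt _]; apply: is_derive_Phi.
  exact: lt_le_trans (le_trans x1 xt).
have lt_phi t : 1 <= t -> phi al t < phi be t.
  move=> t1; have t0 := lt_le_trans ltr01 t1.
  rewrite !phiE // ltr_pM2l // ltrD2r flux_inv_lt ?arg_ge //.
  by rewrite ltr_pM2r // invr_gt0 exprn_gt0.
have D12 : Phi al 2 - Phi al 1 < Phi be 2 - Phi be 1.
  apply: (lt_increment _ (fun t => @dP al 1 2 t (lexx 1))
    (fun t => @dP be 1 2 t (lexx 1))); first by rewrite ltr1n.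
  by move=> t /andP[t1 _]; exact: lt_phi.
have Dy y : 2 <= y -> Phi al y - Phi al 2 <= Phi be y - Phi be 2.
  have l12 : 1 <= 2 :> R by rewrite ler1n.
  move=> y2; apply: (le_increment y2 (fun t => @dP al 2 y t l12)
    (fun t => @dP be 2 y t l12)).
  by move=> t /andP[t2 _]; rewrite ltW // lt_phi // (le_trans l12).
have : Phi be 2 - Phi al 2 <= (Phi be 1 + nu be) - (Phi al 1 + nu al).
  apply: (cvg_pinfty_ge (cvgB (Phi_cvg Ube) (Phi_cvg Ual))) => y /Dy H.
  by rewrite -[leRHS]/(Phi be y - Phi al y); lra.
lra.
Qed.

(** The integral is cut at a radius [r]: the two tails cost e/8 each, uniformly for parameters up to
    [A], and the part on [1, r] costs e/4. *)
Lemma nu_unif A e : 0 < e -> exists2 d, 0 < d & forall al be,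
  flux U0 <= al <= A -> flux U0 <= be <= A -> `|al - be| < d ->
  `|nu al - nu be| < e.
Proof.
move=> e0; pose C := lin_const * (`|flux U0| + `|A|).
have C0 : 0 <= C by rewrite mulr_ge0 ?lin_const_ge0 // addr_ge0.
pose r := 1 + 8 * C / e.
have r1 : 1 <= r.
  by rewrite /r lerDl; apply: divr_ge0; [apply: mulr_ge0; rewrite ?ler0n|exact: ltW].
have r0 := lt_le_trans ltr01 r1.
have tail al : flux U0 <= al <= A -> `|Phi al r - Phi al 1 - nu al| <= e / 8.
  move=> /andP[Ual alA]; apply: le_trans (nu_tail Ual r1) _.
  apply: (@le_trans _ _ (C / r)).
    apply: ler_pM.
    - by rewrite mulr_ge0 ?lin_const_ge0.
    - by rewrite invr_ge0 exprn_ge0 // ltW.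
    - rewrite ler_wpM2l ?lin_const_ge0 //; have [al0|al0] := leP 0 al.
        rewrite (ger0_norm al0) (le_trans alA) // (le_trans (ler_norm A)) //.
        by rewrite lerDr.
      rewrite (ltr0_norm al0) (ltr0_norm flux_U0_lt0).
      by rewrite (@le_trans _ _ (- flux U0)) ?lerN2 // lerDl.
    - rewrite lef_pV2 ?posrE ?exprn_gt0 //.
      by rewrite -[leLHS]expr1 ler_weXn2l // subn_gt0.
  rewrite ler_pdivrMr // /r.
  have -> : e / 8 * (1 + 8 * C / e) = e / 8 + C by field; rewrite gt_eqF.
  by rewrite lerDr divr_ge0 // ltW.
(* Both the weight t and the length of [1, r] are at most r, which accounts for the factor r^2. *)
have [d d0 Hd] : exists2 d, 0 < d & forall z z', `|z - z'| < d ->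
    `|G z - G z'| < e / (4 * r ^+ 2).
  by apply: flux_inv_unif; rewrite divr_gt0 // mulr_gt0 // exprn_gt0.
exists d => // al bet Ual Ube albe.
have P ga de : `|ga - de| < d ->
    Phi ga r - Phi ga 1 - (Phi de r - Phi de 1) <= e / 4.
  move=> gade; pose g (t : R) := e / (4 * r) * t.
  have dP be (t : R) : 1 <= t <= r -> is_derive t 1 (Phi be) (phi be t).
    by move=> /andP[t1 _]; exact: is_derive_Phi (lt_le_trans ltr01 t1).
  have dD (t : R) : 1 <= t <= r ->
      is_derive t 1 (Phi ga - Phi de) (phi ga t - phi de t).
    by move=> t1r; exact: is_deriveB (dP ga t t1r) (dP de t t1r).
  have dg (t : R) : 1 <= t <= r -> is_derive t 1 g (e / (4 * r)).
    move=> _; have := is_deriveZ (e / (4 * r)) (is_derive_id t (1 : R)).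
    by rewrite [_%:A]mulr1.
  have := le_increment r1 dD dg _; rewrite -![(_ - _) _]/(_ - _) /g => H.
  have : Phi ga r - Phi de r - (Phi ga 1 - Phi de 1) <= e / (4 * r) * r - e / (4 * r) * 1.
    apply: H => t /andP[t1 tr]; have t0 := lt_le_trans ltr01 t1.
    rewrite !phiE // -mulrBr.
    rewrite (_ : _ - _ - _ = G (ga / t ^+ n) - G (de / t ^+ n)); last by ring.
    have : `|ga / t ^+ n - de / t ^+ n| < d.
      apply: le_lt_trans gade; rewrite -mulrBl normrM ler_piMr //.
      by rewrite ger0_norm ?invr_ge0 ?exprn_ge0 ?(ltW t0) // invf_le1
        ?exprn_gt0 // exprn_ege1.
    move=> /Hd /ltW /(le_trans (ler_norm _)) HG.
    have -> : e / (4 * r) = r * (e / (4 * r ^+ 2)) by field; rewrite gt_eqF.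
    apply: (@le_trans _ _ (t * (e / (4 * r ^+ 2)))).
      by rewrite ler_wpM2l // ltW.
    by rewrite ler_wpM2r // divr_ge0 ?mulr_ge0 ?exprn_ge0 ?ltW.
  have -> : e / (4 * r) * r = e / 4 by field; rewrite gt_eqF.
  have : 0 <= e / (4 * r) * 1 by rewrite mulr1 divr_ge0 ?mulr_ge0 // ltW.
  lra.
have H1 := P al bet albe; have H2 := P bet al; rewrite distrC in H2.
move: (H2 albe) (tail _ Ual) (tail _ Ube); rewrite !ler_norml.
move=> {}H2 /andP[T1 T2] /andP[T3 T4].
by rewrite ltr_norml; apply/andP; split; lra.
Qed.

Lemma nu_unbounded c : exists2 be, 0 <= be & c <= nu be.
Proof.
(* With be = 2^n flux Y the profile is at least Y on [1, 2], so [phi] is at least |c| there; on the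
   rest it is nonnegative. *)
pose Y := a + `|c|; have aY : a <= Y by rewrite lerDl.
have UY : U0 <= Y by rewrite (le_trans _ aY) // ltW // U0_lt_a.
pose be := 2 ^+ n * flux Y.
have FY : 0 <= flux Y by rewrite -flux_a flux_le // ltW // U0_lt_a.
have be0 : 0 <= be by rewrite mulr_ge0.
exists be => //.
have Ube : flux U0 <= be by rewrite (le_trans (ltW flux_U0_lt0)).
have dP (t : R) : 1 <= t <= 2 -> is_derive t 1 (Phi be) (phi be t).
  by move=> /andP[t1 _]; exact: is_derive_Phi (lt_le_trans ltr01 t1).
have dg (t : R) : 1 <= t <= 2 -> is_derive t 1 (fun t : R => `|c| * t) `|c|.
  move=> _; have := is_deriveZ `|c| (is_derive_id t (1 : R)).
  by rewrite [_%:A]mulr1.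
have l12 : 1 <= 2 :> R by rewrite ler1n.
have H : `|c| * 2 - `|c| * 1 <= Phi be 2 - Phi be 1.
  apply: (le_increment l12 dg dP) => t /andP[t1 t2].
  have t0 := lt_le_trans ltr01 t1; rewrite phiE //.
  have YG : Y <= G (be / t ^+ n).
    rewrite -{1}(fluxK UY) flux_inv_le // ler_pdivlMr ?exprn_gt0 //.
    by rewrite mulrC ler_wpM2r // lerXn2r ?nnegrE // ltW.
  apply: (@le_trans _ _ (t * `|c|)); first by rewrite ler_peMl.
  by rewrite ler_wpM2l // ?(ltW t0) // lerBrDl.
have : Phi be 2 <= Phi be 1 + nu be.
  apply: (cvg_pinfty_ge (Phi_cvg Ube)) => y y2.
  by apply: Phi_mono => //; exact: y2.
have := ler_norm c; lra.
Qed.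

Lemma nu_surj al0 al1 c : flux U0 <= al0 -> al0 <= al1 ->
  nu al0 <= c <= nu al1 -> exists2 al, al0 <= al <= al1 & nu al = c.
Proof.
move=> Ual0 le01 /andP[c0 c1].
have cn : {within `[al0, al1], continuous nu}.
  apply/subspace_continuousP => x; rewrite /= in_itv /= => /andP[x0 x1].
  apply/cvgrPdist_lt => e /(nu_unif al1)[d d0 Hd].
  rewrite near_withinE; exists d => //= t td; rewrite in_itv /= => /andP[t0 t1].
  by apply: Hd => //; rewrite ?x1 ?t1 andbT (le_trans Ual0).
have [|al] := @IVT _ nu al0 al1 c le01 cn; first by rewrite ge_min c0 le_max c1 orbT.
by rewrite in_itv /= => alin <-; exists al.
Qed.

(* [W] is u'(r)/r for the radial solution u, and [W'] is its derivative. *)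
Definition W (al r : R) := G (al / r ^+ n).
Definition W' (al r : R) :=
  - (n%:R * al / r ^+ n.+1) / dflux (W al r).
(** This is b plus the integral of s W(s) from 1 to r, with the quadratic growth split off so that
    the remaining integral converges at infinity. *)
Definition sol (b al r : R) := b + (Phi al r - Phi al 1) + a / 2 * (r ^+ 2 - 1).

Lemma sol1 b al : sol b al 1 = b.
Proof. by rewrite /sol expr1n !subrr mulr0 !addr0. Qed.

Lemma is_derive_sol b al (r : R) : 1 <= r ->
  is_derive r 1 (sol b al) (r * W al r).
Proof.
move=> r1; have dP := is_derive_Phi al (lt_le_trans ltr01 r1).
have D : is_derive r 1 (sol b al) _ := is_deriveD (is_deriveD
  (is_derive_cst b r (1 : R)) (is_deriveB dP (is_derive_cst (Phi al 1) r (1 : R))))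
  (is_deriveZ (a / 2) (is_deriveB (is_derive_pow 2 r)
    (is_derive_cst (1 : R) r (1 : R)))).
apply: (is_derive_eq D); rewrite phiE // /W /GRing.scale /= expr1.
by field.
Qed.

Lemma sol_asymptotics b al r : flux U0 <= al -> 1 <= r ->
  `|sol b al r - (a / 2 * r ^+ 2 + (b - a / 2 + nu al))|
    <= lin_const * `|al| / r ^+ (n - 2).
Proof.
move=> Ual r1; apply: le_trans (nu_tail Ual r1).
by rewrite le_eqVlt; apply/orP; left; apply/eqP; congr `|_|; rewrite /sol; ring.
Qed.

Lemma is_derive_W al (r : R) : flux U0 <= al -> 1 < r ->
  is_derive r 1 (W al) (W' al r).
Proof.
move=> Ual r1; have r0 := lt_trans ltr01 r1.
have rn0 : r ^+ n != 0 by rewrite gt_eqF // exprn_gt0.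
pose h (t : R) := al / t ^+ n.
have Dh : is_derive r 1 h _ := is_deriveZ al (@is_deriveV _
  (fun t : R => t ^+ n) r _ 1 rn0 (is_derive_pow n r)).
have D := is_derive1_comp (is_derive_flux_inv (arg_gt Ual r1) : is_derive (h r) _ _ _) Dh.
apply: (is_derive_eq D); rewrite /W' mulrC; congr (_ / _).
rewrite /GRing.scale /= -[in X in _ = X](@prednK n) ?(ltn_trans _ n2) //.
case: (n) n2 rn0 => // q _; rewrite !exprS /= => rn0.
by field; move: rn0; rewrite mulf_eq0 negb_or => /andP[-> ->].
Qed.

Lemma W_continuous al (r : R) : 0 < r -> {for r, continuous (W al)}.
Proof.
move=> r0; rewrite /prop_for /continuous_at /W.
apply: (@continuous_cvg _ _ _ _ _ _ G); first exact: flux_inv_continuous.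
apply: cvgM; first exact: cvg_cst.
by apply: cvgV; [rewrite gt_eqF // exprn_gt0|exact: exprn_continuous].
Qed.

Lemma W'_continuous al (r : R) : flux U0 <= al -> 1 < r ->
  {for r, continuous (W' al)}.
Proof.
move=> Ual r1; have r0 := lt_trans ltr01 r1.
have Wc := @W_continuous al r r0.
have UW : U0 < W al r.
  by rewrite -(fluxK (lexx U0)) flux_inv_lt // arg_gt.
rewrite /prop_for /continuous_at /W'; apply: cvgM.
  apply: cvgN; apply: cvgM; first exact: cvg_cst.
  by apply: cvgV; [rewrite gt_eqF // exprn_gt0|exact: exprn_continuous].
apply: cvgV; first by rewrite gt_eqF // dflux_gt0.
apply: (@continuous_cvg _ _ _ _ _ _ dflux) => //.
rewrite /prop_for /continuous_at /dflux; apply: cvgB.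
  by apply: cvgM; [exact: cvg_cst|apply: cvgM; [exact: cvg_cst|exact: exprn_continuous]].
by apply: cvgM; [exact: cvg_cst|apply: cvgM; [exact: cvg_cst|exact: exprn_continuous]].
Qed.

(** Explains the integrand of [mu_]: dividing flux (W) = al / s^n by cl W^l gives 1 + al / (cl s^n
    W^l) = ck W^(k-l) / cl = (W / a)^(k-l), so the root is W / a. *)
Lemma Phi_integral_W al s : flux U0 <= al -> 1 < s ->
  s * ((1 + al / (cl * s ^+ n * W al s ^+ l)) `^ (k - l)%:R^-1 - 1)
  = a^-1 * phi al s.
Proof.
move=> Ual s1; have s0 := lt_trans ltr01 s1.
rewrite phiE ?ltW // -/(W al s).
have UW : U0 <= W al s by exact: flux_inv_ge.
have W0 := le_trans U00 UW.
have Wl0 : 0 < W al s ^+ l.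
  by apply: lt_le_trans U0l_gt0 _; rewrite lerXn2r ?nnegrE.
have E : W al s ^+ l * (ck * W al s ^+ (k - l) - cl) = al / s ^+ n.
  by rewrite -fluxE flux_invK // ltW // arg_gt.
have sn0 : 0 < s ^+ n by rewrite exprn_gt0.
have -> : 1 + al / (cl * s ^+ n * W al s ^+ l) = (W al s / a) ^+ (k - l).
  have -> : al / (cl * s ^+ n * W al s ^+ l) = al / s ^+ n / (cl * W al s ^+ l).
    by field; rewrite !gt_eqF.
  rewrite -E expr_div_n -aE.
  have ad0 : 0 < a ^+ (k - l) by rewrite exprn_gt0.
  by field; rewrite !gt_eqF.
rewrite -powR_mulrn ?divr_ge0 // ?(ltW a0) // -powRrM divff; last first.
  by rewrite pnatr_eq0 -lt0n.
rewrite powRr1 ?divr_ge0 // ?(ltW a0) //.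
by field; rewrite gt_eqF.
Qed.

(** * The exterior problem *)

Section ExteriorProblem.
Variable m : nat.
Variable Uh : R.
Hypotheses (km : (k <= m)%N) (mn : (m <= n)%N) (k2 : (1 < k)%N).
Hypotheses (Uh0 : 0 <= Uh).
Hypothesis UhE : (k < m)%N ->
  (m - k)%:R * ck * Uh ^+ (k - l) = (m - l)%:R * cl.
Hypotheses (ckE : ck = 'C(n, k)%:R) (clE : cl = 'C(n, l)%:R).
Hypothesis aH : a = a_hat R n k l.
Hypothesis U0H : U0 = U_low R n k l.

Let n0 : (0 < n)%N. Proof. exact: ltn_trans n2. Qed.
Let nR : 0 < n%:R :> R. Proof. by rewrite ltr0n. Qed.

(** Multiplication by [w] removes the truncated exponents, so l = 0 needs no separate treatment. *)
Lemma mul_dflux w : w * dflux w = k%:R * (ck * w ^+ k) - l%:R * (cl * w ^+ l).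
Proof.
have E j (x : R) : w * (x * (j%:R * w ^+ j.-1)) = j%:R * (x * w ^+ j).
  by case: j => [|j]; [rewrite !mul0r !mulr0|rewrite exprS /=; ring].
by rewrite /dflux mulrBr !E.
Qed.

(** For w > 0 the sign of the bracket gives all the conditions: j = 0 yields U0 < w, j = k is always
    positive, and j = m > k yields w < Uh. *)
Lemma mul_dflux_sub w j : w * dflux w - j%:R * flux w =
  w ^+ l * ((k%:R - j%:R) * ck * w ^+ (k - l) - (l%:R - j%:R) * cl).
Proof.
have Ek : w ^+ k = w ^+ l * w ^+ (k - l) by rewrite -exprD subnKC // ltnW.
by rewrite mul_dflux /flux Ek; ring.
Qed.

(* [q] stands for r w'(r): the eigenvalues of the Hessian are [w] (n - 1 times)
   and [w + q], and the hypothesis is the equation S_k = S_l. The sign of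
   [n w + j q], hence that of S_j, is thus read off from [w] alone. *)
Lemma dflux_balance w q j : n%:R * flux w + q * dflux w = 0 ->
  (w * dflux w) * (n%:R * w + j%:R * q) =
  n%:R * w * (w * dflux w - j%:R * flux w).
Proof.
move=> H.
have : j%:R * w * (n%:R * flux w + q * dflux w) = 0 by rewrite H mulr0.
by move=> E; apply/eqP; rewrite -subr_eq0 -E; apply/eqP; ring.
Qed.

Lemma flux_k_gt0 w : 0 < w -> 0 < w * dflux w - k%:R * flux w.
Proof.
move=> w0; rewrite mul_dflux_sub subrr !mul0r sub0r -mulNr opprB.
by rewrite !mulr_gt0 ?exprn_gt0 // subr_gt0 ltr_nat.
Qed.

Lemma flux_m_gt0 w : 0 < w -> (k < m)%N ->
  (0 < w * dflux w - m%:R * flux w) = (w < Uh).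
Proof.
move=> w0 ltkm; have mk0 : 0 < (m - k)%:R :> R by rewrite ltr0n subn_gt0.
rewrite mul_dflux_sub pmulr_rgt0 ?exprn_gt0 //.
have -> : (k%:R - m%:R) * ck * w ^+ (k - l) - (l%:R - m%:R) * cl =
   (m - k)%:R * ck * (Uh ^+ (k - l) - w ^+ (k - l)).
  rewrite mulrBr UhE // !natrB //; last by rewrite ltnW // (ltn_trans lk).
  ring.
by rewrite !pmulr_rgt0 // subr_gt0 ltr_pXn2r ?nnegrE // ltW.
Qed.

Lemma mul_dflux_gt0 w : 0 < w -> (0 < w * dflux w) = (U0 < w).
Proof.
move=> w0; have := mul_dflux_sub w 0; rewrite mul0r subr0 => ->.
rewrite !subr0 -U0E -mulrBr pmulr_rgt0 ?exprn_gt0 // pmulr_rgt0.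
  by rewrite subr_gt0 ltr_pXn2r ?nnegrE // ltW.
by rewrite mulr_gt0 // ltr0n.
Qed.

(** The expression is affine in j and positive at j = 0 and j = m; the whole cone condition thus
    reduces to its last index. *)
Lemma pos_ladder (w q : R) j : 0 < w -> 0 < n%:R * w + m%:R * q -> (j <= m)%N ->
  0 < n%:R * w + j%:R * q.
Proof.
move=> w0 H jm; have [q0|q0] := leP 0 q.
  by rewrite ltr_wpDr ?mulr_gt0 // mulr_ge0.
apply: lt_le_trans H _; rewrite lerD2l ler_nM2r // ler_nat //.
Qed.

(** A form valid at j = 0 too, since S_l occurs with l = 0. *)
Lemma radial_S_all (f w w1 : R -> R) (u : 'rV[R]_n -> R) (x : 'rV[R]_n) j :
  (forall y, ext_open y -> u y = f (enorm y)) ->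
  (forall r : R, 1 < r -> is_derive r 1 f (r * w r)) ->
  (forall r : R, 1 < r -> is_derive r 1 w (w1 r)) -> ext_open x ->
  n%:R * S_ j u x = 'C(n, j)%:R * (n%:R * w (enorm x) ^+ j +
    j%:R * w (enorm x) ^+ j.-1 * (enorm x * w1 (enorm x))).
Proof.
move=> uf fw ww1 x1; case: j => [|j]; last first.
  rewrite (radial_S_ uf fw ww1) //= exprS.
  by field; rewrite gt_eqF.
rewrite /S_ /esigma (big_pred1 finset.set0) => [|I]; last first.
  by rewrite /= finset.cards_eq0.
by rewrite finset.big_set0 bin0 !mul0r addr0 expr0 mul1r mulr1.
Qed.

Lemma S_quotient (f w w1 : R -> R) (u : 'rV[R]_n -> R) (x : 'rV[R]_n) :
  (forall y, ext_open y -> u y = f (enorm y)) ->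
  (forall r : R, 1 < r -> is_derive r 1 f (r * w r)) ->
  (forall r : R, 1 < r -> is_derive r 1 w (w1 r)) -> ext_open x ->
  (S_ k u x = S_ l u x) <->
  n%:R * flux (w (enorm x)) + (enorm x * w1 (enorm x)) * dflux (w (enorm x)) = 0.
Proof.
move=> uf fw ww1 x1.
have E : n%:R * (S_ k u x - S_ l u x) = n%:R * flux (w (enorm x)) +
    (enorm x * w1 (enorm x)) * dflux (w (enorm x)).
  rewrite mulrBr !(radial_S_all _ uf fw ww1) // /flux /dflux ckE clE; ring.
rewrite -E; split=> [->|/eqP]; first by rewrite subrr mulr0.
by rewrite mulf_eq0 gt_eqF //= subr_eq0 => /eqP.
Qed.

Definition admissible (al : R) := flux U0 <= al /\ ((k < m)%N -> al <= flux Uh).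

Lemma U0_lt_W al (r : R) : flux U0 <= al -> 1 < r -> U0 < W al r.
Proof.
by move=> Ual r1; rewrite -(fluxK (lexx U0)) flux_inv_lt // arg_gt.
Qed.

Lemma a_lt_Uh : (k < m)%N -> a < Uh.
Proof.
move=> ltkm; have mk0 : 0 < (m - k)%:R :> R by rewrite ltr0n subn_gt0.
have : (m - k)%:R * ck * a ^+ (k - l) < (m - k)%:R * ck * Uh ^+ (k - l).
  rewrite UhE // -mulrA aE ltr_pM2r // ltr_nat; lia.
by rewrite ltr_pM2l ?mulr_gt0 // ltr_pXn2r ?nnegrE // ltW.
Qed.

Lemma flux_Uh_gt0 : (k < m)%N -> 0 < flux Uh.
Proof.
by move=> /a_lt_Uh aU; rewrite -flux_a flux_lt // ltW // U0_lt_a.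
Qed.

Lemma W_lt_Uh al (r : R) : admissible al -> (k < m)%N -> 1 < r -> W al r < Uh.
Proof.
move=> [Ual alU] ltkm r1; have F0 := flux_Uh_gt0 ltkm.
have UU : U0 <= Uh by rewrite ltW // (lt_trans U0_lt_a) // a_lt_Uh.
rewrite -(fluxK UU) flux_inv_lt //; first by rewrite arg_ge // ltW.
have rn1 : 1 < r ^+ n by rewrite exprn_egt1 // -lt0n.
rewrite ltr_pdivrMr ?(lt_trans ltr01) //; apply: le_lt_trans (alU ltkm) _.
by rewrite ltr_pMr.
Qed.

Lemma flux_W al (r : R) : flux U0 <= al -> 1 < r -> flux (W al r) = al / r ^+ n.
Proof. by move=> Ual r1; rewrite flux_invK // ltW // arg_gt. Qed.

Lemma W_balance al (r : R) : flux U0 <= al -> 1 < r ->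
  n%:R * flux (W al r) + (r * W' al r) * dflux (W al r) = 0.
Proof.
move=> Ual r1; rewrite flux_W // /W'.
have d0 : dflux (W al r) != 0 by rewrite gt_eqF // dflux_gt0 // U0_lt_W.
have r0 := lt_trans ltr01 r1; have rn0 : r ^+ n != 0 by rewrite gt_eqF // exprn_gt0.
by rewrite exprS; field; rewrite d0 rn0 gt_eqF.
Qed.

Lemma sol_in_Phi b al : admissible al ->
  Phi_ m (fun x : 'rV[R]_n => sol b al (enorm x)) /\
  dirichlet_solution k l b (fun x : 'rV[R]_n => sol b al (enorm x)).
Proof.
move=> adm; have [Ual alU] := adm; set u := fun x => _.
have uf y : ext_open y -> u y = sol b al (enorm y) by [].
have fw (r : R) : 1 < r -> is_derive r 1 (sol b al) (r * W al r).
  by move=> /ltW; exact: is_derive_sol.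
have ww1 (r : R) : 1 < r -> is_derive r 1 (W al) (W' al r).
  exact: is_derive_W.
have Spos x j : ext_open x -> (j <= m)%N -> 0 < S_ j u x.
  move=> x1 jm; have W0 := le_lt_trans U00 (U0_lt_W Ual x1).
  have dpos : 0 < W al (enorm x) * dflux (W al (enorm x)).
    by rewrite mul_dflux_gt0 // U0_lt_W.
  have Hm : 0 < n%:R * W al (enorm x) + m%:R * (enorm x * W' al (enorm x)).
    rewrite -(pmulr_rgt0 _ dpos) dflux_balance; last exact: W_balance.
    rewrite pmulr_rgt0 ?mulr_gt0 //.
    move: km; rewrite leq_eqVlt => /orP[/eqP <-|ltkm]; first exact: flux_k_gt0.
    by rewrite flux_m_gt0 // W_lt_Uh.
  have Hj := pos_ladder W0 Hm jm.
  rewrite -(pmulr_rgt0 _ nR) (radial_S_all _ uf fw ww1) //.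
  have C0 : 0 < 'C(n, j)%:R :> R by rewrite ltr0n bin_gt0 (leq_trans jm).
  rewrite pmulr_rgt0 //; case: j {jm C0} Hj => [|j] Hj.
    by rewrite !mul0r addr0 expr0 mulr1.
  rewrite (_ : _ + _ = W al (enorm x) ^+ j * (n%:R * W al (enorm x) +
    j.+1%:R * (enorm x * W' al (enorm x)))); last by rewrite exprS /=; ring.
  by rewrite pmulr_rgt0 // exprn_gt0.
split; last first.
  split=> [x x1|x]; last first.
    by rewrite /unit_sphere /= /u => ->; rewrite sol1.
  have Sl : S_ l u x != 0 by rewrite gt_eqF // Spos // ltnW // (leq_trans lk).
  have -> : S_ k u x = S_ l u x by apply/(S_quotient uf fw ww1 x1); exact: W_balance.
  by rewrite divff.
split.
- apply: (@radial_C1_ext_closed _ _ _ (W al)) => r r1.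
    exact: is_derive_sol.
  exact: W_continuous (lt_le_trans ltr01 r1).
- apply: (radial_C2 uf fw ww1) => r r1; exact: W'_continuous.
- by move=> x x1 j /andP[_ jm]; exact: Spos.
- by move=> x y _ xy; rewrite /u xy.
Qed.

(** * From a solution back to its parameter *)

Lemma exprn_surj (t : R) : 1 < t -> exists2 r, 1 < r & r ^+ n = t.
Proof.
move=> t1; have t0 := lt_trans ltr01 t1.
have E : (t `^ n%:R^-1) ^+ n = t.
  by rewrite -powR_mulrn ?powR_ge0 // -powRrM mulVf ?gt_eqF // powRr1 // ltW.
exists (t `^ n%:R^-1) => //; rewrite ltNge; apply/negP => r1.
move: t1; rewrite -E ltNge => /negP; apply.
by rewrite exprn_ile1 // powR_ge0.
Qed.

(** The passage r -> 1 without limits: r^n takes every value above 1, and r^n = 1 + e / (|z| + 1)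
    makes r^n z at most z + e. *)
Lemma le_scaled (x z : R) : (forall r : R, 1 < r -> x <= r ^+ n * z) -> x <= z.
Proof.
move=> H; apply/ler_addgt0Pr => e e0.
have z1 : 0 < `|z| + 1 by rewrite ltr_wpDl.
have [|r r1 rE] := @exprn_surj (1 + e / (`|z| + 1)).
  by rewrite ltrDl divr_gt0.
apply: le_trans (H r r1) _; rewrite rE mulrDl mul1r lerD2l.
rewrite mulrAC ler_pdivrMr // ler_pM2l // (le_trans (ler_norm z)) //.
by rewrite lerDl.
Qed.

Lemma ge_scaled (x z : R) : (forall r : R, 1 < r -> r ^+ n * z <= x) -> z <= x.
Proof.
move=> H; rewrite -lerN2; apply: le_scaled => r r1.
by rewrite mulrN lerN2 H.
Qed.

(** The derivative of r^n flux (w(r)) is r^(n-1) times the left-hand side of the equation. *)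
Lemma ode_first_integral (w w1 : R -> R) :
  (forall r : R, 1 < r -> is_derive r 1 w (w1 r)) ->
  (forall r : R, 1 < r -> n%:R * flux (w r) + (r * w1 r) * dflux (w r) = 0) ->
  exists al, forall r : R, 1 < r -> flux (w r) = al / r ^+ n.
Proof.
move=> ww1 H; pose h (r : R) := r ^+ n * flux (w r).
have dh (r : R) : 1 < r -> is_derive r 1 h 0.
  move=> r1; have D : is_derive r 1 h _ := is_deriveM (is_derive_pow n r)
    (is_derive1_comp (is_derive_flux (w r)) (ww1 r r1)).
  apply: (is_derive_eq D); rewrite /GRing.scale /=.
  rewrite -[RHS](mulr0 (r ^+ n.-1)) -(H r r1) -{1}(prednK n0) exprS; ring.
have d0 (r : R) : is_derive r 1 (cst (0 : R)) 0 by exact: is_derive_cst.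
have le_h x y : 1 < x -> x <= y -> h x = h y.
  move=> x1 xy; have dxy (t : R) : x <= t <= y -> is_derive t 1 h 0.
    by move=> /andP[xt _]; apply: dh; exact: lt_le_trans xt.
  have H1 := le_increment xy dxy (fun t _ => d0 t) (fun t _ => lexx 0).
  have H2 := le_increment xy (fun t _ => d0 t) dxy (fun t _ => lexx 0).
  by apply/eqP; rewrite eq_le -subr_ge0 -[h y <= _]subr_le0 andbC;
    move: H1 H2; rewrite subrr => -> ->.
exists (h 2) => r r1; have r0 := lt_trans ltr01 r1.
have -> : h 2 = h r.
  have l2 : 1 < 2 :> R by rewrite ltr1n.
  by have [r2|/ltW r2] := leP 2 r; [exact: le_h|apply/esym; exact: le_h].
by rewrite /h mulrAC divff ?mul1r // gt_eqF // exprn_gt0.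
Qed.

Lemma Gamma_profile (f w w1 : R -> R) (u : 'rV[R]_n -> R) (x : 'rV[R]_n) :
  (forall y, ext_open y -> u y = f (enorm y)) ->
  (forall r : R, 1 < r -> is_derive r 1 f (r * w r)) ->
  (forall r : R, 1 < r -> is_derive r 1 w (w1 r)) -> ext_open x ->
  Gamma_ m (eigvals (hessian u x)) -> S_ k u x / S_ l u x = 1 ->
  [/\ n%:R * flux (w (enorm x)) + (enorm x * w1 (enorm x)) * dflux (w (enorm x)) = 0,
      U0 < w (enorm x) & (k < m)%N -> w (enorm x) < Uh].
Proof.
move=> uf fw ww1 x1 Gx Skl; set v := w (enorm x); set q := enorm x * w1 (enorm x).
have E : S_ k u x = S_ l u x.
  (* Division by zero gives 0, so a quotient equal to 1 excludes S_l = 0. *)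
  apply/eqP; move: Skl; have [->|Sl0] := eqVneq (S_ l u x) 0.
    by rewrite invr0 mulr0 => /eqP; rewrite eq_sym oner_eq0.
  by move=> /divr1_eq ->.
have B : n%:R * flux v + q * dflux v = 0 by apply/(S_quotient uf fw ww1 x1).
have Sj j : (1 <= j <= m)%N -> 0 < n%:R * v ^+ j + j%:R * v ^+ j.-1 * q.
  move=> jm; have : 0 < n%:R * S_ j u x by rewrite pmulr_rgt0 //; exact: Gx.
  rewrite (radial_S_all _ uf fw ww1) // pmulr_rgt0 // ltr0n bin_gt0.
  by have /andP[_ /leq_trans ->] := jm.
have m2 : (2 <= m)%N by exact: leq_trans km.
(* This uses m >= 2: if v <= 0, then S_1 > 0 forces n v + 2 q > 0, which makes S_2 nonpositive. *)
have v0 : 0 < v.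
  have := Sj 1%N; rewrite /= (ltnW m2) expr1 expr0 !mul1r => /(_ isT) S1.
  have := Sj 2%N; rewrite /= m2 expr1 => /(_ isT) S2.
  have {}S2 : 0 < v * (n%:R * v + 2 * q) by move: S2; rewrite expr2; congr (_ < _); ring.
  rewrite ltNge; apply/negP => v0.
  have nv : n%:R * v <= 0 by rewrite mulr_ge0_le0 // ltW.
  have : v * (n%:R * v + 2 * q) <= 0 by rewrite mulr_le0_ge0 //; lra.
  by rewrite leNgt S2.
have Hj j : (1 <= j <= m)%N -> 0 < n%:R * v + j%:R * q.
  move=> jm; have := Sj j jm; case: j jm => // j _.
  rewrite (_ : n%:R * _ + _ = v ^+ j * (n%:R * v + j.+1%:R * q)).
    by rewrite pmulr_rgt0 // exprn_gt0.
  by rewrite exprS /=; ring.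
(* In the balance identity at j = k the right-hand side is positive for every v > 0, so S_k > 0
   decides the sign of [dflux v] and hence the branch. *)
have dpos : 0 < v * dflux v.
  have k1m : (1 <= k <= m)%N by rewrite k0.
  rewrite -(pmulr_lgt0 _ (Hj k k1m)) dflux_balance //.
  by rewrite mulr_gt0 ?flux_k_gt0 // mulr_gt0.
split=> //; first by rewrite -mul_dflux_gt0.
move=> ltkm; rewrite -flux_m_gt0 //.
have nv : 0 < n%:R * v by rewrite mulr_gt0.
rewrite -(pmulr_rgt0 _ nv) -(dflux_balance _ B) mulr_gt0 // Hj //.
by rewrite (leq_trans _ m2) /=.
Qed.

Lemma solution_is_sol b (u : 'rV[R]_n -> R) : Phi_ m u -> dirichlet_solution k l b u ->
  exists2 al, admissible al & forall x, ext_closed x -> u x = sol b al (enorm x).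
Proof.
move=> [[cu _ _] [[_ C1] C2] Gu ru] [Su bu].
(* By radial symmetry one coordinate axis determines [u], and the derivatives of the profile are
   partial derivatives along it. *)
pose i := Ordinal n0; pose e : 'rV[R]_n := delta_mx 0 i.
pose f (r : R) := u (r *: e).
have er (r : R) : 0 <= r -> enorm (r *: e) = r by exact: enorm_delta.
have eo (r : R) : 1 < r -> ext_open (r *: e).
  by move=> r1; rewrite /ext_open /= er // ltW // (lt_trans ltr01).
have df (r : R) : 1 < r -> is_derive r 1 f (partial i u (r *: e)).
  by move=> r1; apply: is_derive_ray; have [+ _] := C1 i; apply; exact: eo.
pose f1 (r : R) := partial i u (r *: e).
have df1 (r : R) : 1 < r -> is_derive r 1 f1 (partial i (partial i u) (r *: e)).
  by move=> r1; apply: is_derive_ray; have [_ /(_ i)[+ _]] := C2 i; apply; exact: eo.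
pose w (r : R) := r^-1 * f1 r.
pose w1 (r : R) := partial i (partial i u) (r *: e) / r - f1 r / r ^+ 2.
have uf x : ext_open x -> u x = f (enorm x).
  move=> x1; apply: ru; first exact: ltW.
  by rewrite er // enorm_ge0.
have fw (r : R) : 1 < r -> is_derive r 1 f (r * w r).
  move=> r1; rewrite /w mulrA divff ?mul1r; first exact: df.
  by rewrite gt_eqF // (lt_trans ltr01).
have ww1 (r : R) : 1 < r -> is_derive r 1 w (w1 r).
  move=> r1; have r0 : r != 0 by rewrite gt_eqF // (lt_trans ltr01).
  have D : is_derive r 1 w _ := is_deriveM
    (@is_deriveV _ id r _ 1 r0 (is_derive_id r (1 : R))) (df1 r r1).
  by apply: (is_derive_eq D); rewrite /w1 /GRing.scale /=; field.
have K (r : R) : 1 < r ->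
  [/\ n%:R * flux (w r) + (r * w1 r) * dflux (w r) = 0,
      U0 < w r & (k < m)%N -> w r < Uh].
  move=> r1; have r0 : 0 <= r by rewrite ltW // (lt_trans ltr01).
  have := Gamma_profile uf fw ww1 (eo r r1) (Gu _ (eo r r1)) (Su _ (eo r r1)).
  by rewrite er.
have [|al flw] := ode_first_integral ww1; first by move=> r /K[].
have rn0 (r : R) : 1 < r -> 0 < r ^+ n by move=> r1; rewrite exprn_gt0 // (lt_trans ltr01).
have alE (r : R) : 1 < r -> al = r ^+ n * flux (w r).
  by move=> r1; rewrite flw // mulrC divfK // gt_eqF // rn0.
(* Each r > 1 gives r^n flux U0 < al; letting r -> 1 leaves the non-strict bound, which is why the
   endpoint is included. *)
have Ual : flux U0 <= al.
  apply: ge_scaled => r r1; rewrite (alE r r1) ler_pM2l ?rn0 //.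
  by have [_ Uw _] := K r r1; rewrite ltW // flux_lt.
have adm : admissible al.
  split=> // ltkm; apply: le_scaled => r r1; rewrite (alE r r1) ler_pM2l ?rn0 //.
  by have [_ Uw /(_ ltkm) wU] := K r r1; rewrite ltW // flux_lt // ltW.
have wW (r : R) : 1 < r -> w r = W al r.
  move=> r1; rewrite /W -flw // fluxK //; by have [_ /ltW] := K r r1.
pose D (r : R) := f r - sol b al r.
have dD (r : R) : 1 < r -> is_derive r 1 D 0.
  move=> r1; have dd : is_derive r 1 D _ :=
    is_deriveB (fw r r1) (is_derive_sol b al (ltW r1)).
  by apply: (is_derive_eq dd); rewrite wW // subrr.
(* The equation holds only for r > 1, so the integration constant is fixed by continuity up to the
   sphere. *)
have D1 : D t @[t --> (1:R)^'+] --> (0 : R).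
  have <- : f 1 - sol b al 1 = 0.
    rewrite sol1 /f bu ?subrr // /unit_sphere /= er //.
  apply: cvgB; first exact: ray_cvg1.
  apply: cvg_at_right_filter.
  exact: is_derive_continuous (is_derive_sol b al (lexx 1)).
have D0 (r : R) : 1 < r -> D r = 0.
  move=> r1; apply: (@cvg_unique _ (@Rhausdorff R) _ _ _ _ _ D1).
  apply: (@cvg_trans _ (cst (D r) @ (1:R)^'+)); last exact: cvg_cst.
  apply: near_eq_cvg; near=> t.
  have t1 : 1 < t by near: t; exact: nbhs_right_gt.
  have tr : t <= r by near: t; exact: nbhs_right_le.
  have dxy (s : R) : t <= s <= r -> is_derive s 1 D 0.
    by move=> /andP[ts _]; apply: dD; exact: lt_le_trans ts.
  have d0 (s : R) : t <= s <= r -> is_derive s 1 (cst (0 : R)) 0.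
    by move=> _; exact: is_derive_cst.
  have H1 := le_increment tr dxy d0 (fun t _ => lexx 0).
  have H2 := le_increment tr d0 dxy (fun t _ => lexx 0).
  by apply/eqP; rewrite eq_le -subr_ge0 -[X in _ && X]subr_ge0 /=;
    move: H1 H2; rewrite subrr subr_le0 subr_ge0 !subr_ge0 => -> ->.
exists al => // x; rewrite /ext_closed /= le_eqVlt => /orP[/eqP x1|x1].
  by rewrite -x1 sol1 bu.
by rewrite uf //; apply/eqP; rewrite -subr_eq0; apply/eqP; exact: D0.
Unshelve. all: by end_near. Qed.

(** * Matching parameters with constants at infinity *)

Lemma mu_nu b al : flux U0 <= al -> mu_ n k l b al = b - a / 2 + nu al.
Proof.
move=> Ual; rewrite /mu_ -aH; congr (_ + _).
transitivity (a * Rintegral mu `]1, +oo[ (fun s => a^-1 * phi al s)); last first.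
  have ai : 0 <= a^-1 by rewrite invr_ge0 ltW.
  rewrite (Rintegral_phi ai (Phi_cvg Ual)) mulrA divff ?gt_eqF // mul1r.
  by rewrite addrC addKr.
congr (_ * _); apply: eq_Rintegral.
move=> s; rewrite inE /= in_itv /= andbT => s1.
(* For s > 1 the root exists, namely [W al s], and is unique by injectivity of [flux], so the
   default value of [U_] never enters the integral. *)
suff -> : U_ n k l s al = W al s by rewrite -clE Phi_integral_W.
have s0 : s ^+ n != 0 by rewrite gt_eqF // exprn_gt0 // (lt_trans ltr01).
have ck00 : ck != 0 by rewrite gt_eqF.
have P y : y ^+ k - cl / ck * y ^+ l - al / (ck * s ^+ n) = ck^-1 * (flux y - al / s ^+ n).
  by rewrite /flux; field; rewrite ck00 s0.
apply: xget_unique; rewrite /= /is_U -U0H -ckE -clE.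
  by split; [exact: U0_lt_W|rewrite P flux_W // subrr mulr0].
move=> y [Uy]; rewrite P => /eqP; rewrite mulf_eq0 invr_eq0 (negPf ck00) /=.
rewrite subr_eq0 -flux_W // => /eqP; apply: flux_inj; first exact: ltW.
exact: flux_inv_ge.
Qed.

Lemma sol_asymptotics_x b al (u : 'rV[R]_n -> R) : flux U0 <= al ->
  (forall x, ext_closed x -> u x = sol b al (enorm x)) ->
  asymptotics k l (b - a / 2 + nu al) u.
Proof.
move=> Ual uE; exists (lin_const * `|al|), 1 => x x1; rewrite uE // -aH.
by rewrite exprz_2sub //; exact: sol_asymptotics.
Qed.

Lemma asymptotics_unique c c' (u : 'rV[R]_n -> R) :
  asymptotics k l c u -> asymptotics k l c' u -> c = c'.
Proof.
move=> [M [r0 H]] [M' [r0' H']].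
apply/eqP; rewrite -subr_eq0 -normr_le0; apply/ler_addgt0Pr => e e0; rewrite add0r.
pose B := `|M| + `|M'|; have B0 : 0 <= B by rewrite addr_ge0.
(* Large enough for both expansions to hold and for B / r^(n-2) <= B / r <= e, where n >= 3 is
   used. *)
pose r := 1 + `|r0| + `|r0'| + B / e.
have Be : 0 <= B / e by rewrite divr_ge0 // ltW.
have r1 : 1 <= r by rewrite /r -!addrA lerDl !addr_ge0.
have rpos := lt_le_trans ltr01 r1.
have rr0 : r0 <= r by rewrite /r; have := ler_norm r0; have := normr_ge0 r0'; lra.
have rr0' : r0' <= r by rewrite /r; have := ler_norm r0'; have := normr_ge0 r0; lra.
pose x : 'rV[R]_n := r *: delta_mx 0 (Ordinal n0).
have xr : enorm x = r by rewrite enorm_delta // ltW.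
have := H' x; have := H x; rewrite xr => /(_ rr0) {}H /(_ rr0') {}H'.
rewrite exprz_2sub // in H; rewrite exprz_2sub // in H'.
set p := (r ^+ (n - 2))^-1 in H H'.
have p0 : 0 <= p by rewrite invr_ge0 exprn_ge0 // ltW.
have pB : B * p <= e.
  apply: (@le_trans _ _ (B / r)).
    rewrite ler_wpM2l // lef_pV2 ?posrE ?exprn_gt0 //.
    by rewrite -[leLHS]expr1 ler_weXn2l // subn_gt0.
  rewrite ler_pdivrMr // mulrC -ler_pdivrMr // /r.
  by have := normr_ge0 r0; have := normr_ge0 r0'; lra.
have M1 : M * p <= `|M| * p by rewrite ler_wpM2r // ler_norm.
have M2 : M' * p <= `|M'| * p by rewrite ler_wpM2r // ler_norm.
move: H H'; rewrite !ler_norml => /andP[H1 H2] /andP[H3 H4].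
by move: pB; rewrite /B mulrDl => pB; apply/andP; split; lra.
Qed.

Lemma exterior_iff b c :
  (exists u : 'rV[R]_n -> R,
     [/\ Phi_ m u, dirichlet_solution k l b u & asymptotics k l c u] /\
     (forall v : 'rV[R]_n -> R,
        [/\ Phi_ m v, dirichlet_solution k l b v & asymptotics k l c v] ->
        forall x, ext_closed x -> v x = u x))
  <-> mu_ n k l b (flux U0) <= c /\ ((k < m)%N -> c <= mu_ n k l b (flux Uh)).
Proof.
have nu_le al be : flux U0 <= al -> al <= be -> nu al <= nu be.
  by move=> Ual; rewrite le_eqVlt => /orP[/eqP ->//|/(nu_lt Ual) /ltW].
split.
  move=> [u [[Pu du au] _]]; have [al [Ual alU] uE] := solution_is_sol Pu du.
  rewrite (asymptotics_unique au (sol_asymptotics_x Ual uE)).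
  split; first by rewrite mu_nu // lerD2l nu_le.
  by move=> /alU alU'; rewrite mu_nu ?(le_trans Ual) // lerD2l nu_le.
move=> [c0 c1]; have [al adm cE] : exists2 al, admissible al & b - a / 2 + nu al = c.
  rewrite mu_nu // in c0.
  (* A right end for the intermediate value theorem: [nu_unbounded] supplies it when m = k, and flux
     Uh serves when k < m. *)
  have [be be0 ltbe] : exists2 be, flux U0 <= be /\ ((k < m)%N -> be <= flux Uh) &
      c <= b - a / 2 + nu be.
    have [mk|ltkm] := leqP m k.
      have [be be0 cbe] := nu_unbounded (c - (b - a / 2)).
      exists be; last by rewrite addrC -lerBlDr.
      by split; first by rewrite (le_trans (ltW flux_U0_lt0)).
    have UF : flux U0 <= flux Uh.
      by rewrite (le_trans (ltW flux_U0_lt0)) // ltW // flux_Uh_gt0.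
    by exists (flux Uh) => //; rewrite -mu_nu // c1.
  have [|al /andP[al0 al1] alc] := nu_surj (lexx (flux U0)) be0.1 (c := c - (b - a / 2)).
    by rewrite lerBrDl c0 lerBlDl.
  exists al; last by rewrite alc addrC subrK.
  by split=> // /be0.2; exact: le_trans.
have [Ual alU] := adm; have [Pu du] := sol_in_Phi b adm.
exists (fun x => sol b al (enorm x)); split.
  by split=> //; rewrite -cE; exact: sol_asymptotics_x.
move=> v [Pv dv av] x x1; have [be [Ube beU] vE] := solution_is_sol Pv dv.
rewrite vE //; suff -> : be = al by [].
have : nu be = nu al.
  have := asymptotics_unique av (sol_asymptotics_x Ube vE).
  by rewrite -cE => /addrI.
move=> E; case: (ltgtP be al) => // [/(nu_lt Ube)|/(nu_lt Ual)]; by rewrite E ltxx.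
Qed.

(** As z < 0, every r^n z with r > 1 lies below z; the supremum is the unattained value at r = 1. *)
Lemma sup_scaled (z : R) : z < 0 ->
  sup [set r ^+ n * z | r in [set r : R | 1 < r]] = z.
Proof.
move=> z0; set E := (X in sup X).
have E0 : E !=set0 by exists (2 ^+ n * z), 2 => //=; rewrite ltr1n.
have uE : ubound E z.
  move=> _ [r /= r1 <-]; rewrite ler_neMl ?exprn_ege1 ?ltW //.
apply/eqP; rewrite eq_le ge_sup //=; apply: ge_scaled => r r1.
by apply: ub_le_sup; [exists z|exists r].
Qed.

Lemma inf_scaled (z : R) : 0 < z ->
  inf [set r ^+ n * z | r in [set r : R | 1 < r]] = z.
Proof.
move=> z0; set E := (X in inf X).
have E0 : E !=set0 by exists (2 ^+ n * z), 2 => //=; rewrite ltr1n.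
have lE : lbound E z.
  by move=> _ [r /= r1 <-]; rewrite ler_peMl ?exprn_ege1 ?ltW.
apply/eqP; rewrite eq_le lb_le_inf // andbT; apply: le_scaled => r r1.
by apply: ge_inf; [exists z|exists r].
Qed.

Lemma alpha1E : alpha1 R n k l = flux U0.
Proof. by rewrite -[RHS]sup_scaled ?flux_U0_lt0 // /flux ckE clE U0H. Qed.

Lemma alpha2E : (k < m)%N ->
  Uh = (((m - l) * 'C(n, l))%:R / ((m - k) * 'C(n, k))%:R) `^ (k - l)%:R^-1 ->
  alpha2 R n k l m = flux Uh.
Proof.
by move=> km' UhH; rewrite -[RHS]inf_scaled ?flux_Uh_gt0 // /flux ckE clE UhH.
Qed.

End ExteriorProblem.
End Profile.
End Flux.

Lemma powR_invn_expr (R : realType) (d : nat) (x : R) : 0 <= x -> (0 < d)%N ->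
  (x `^ d%:R^-1) ^+ d = x.
Proof.
move=> x0 d0; rewrite -powR_mulrn ?powR_ge0 // -powRrM mulVf ?powRr1 //.
by rewrite pnatr_eq0 -lt0n.
Qed.

Theorem theorem1p1 (R : realType) (n k m l : nat) (b c : R)
    (hk : (2 <= k)%N) (hkm : (k <= m)%N) (hmn : (m <= n)%N) (hn : (3 <= n)%N)
    (hl : (l < k)%N) :
  (exists u : 'rV[R]_n -> R,
     [/\ Phi_ m u, dirichlet_solution k l b u & asymptotics k l c u] /\
     (forall v : 'rV[R]_n -> R,
        [/\ Phi_ m v, dirichlet_solution k l b v & asymptotics k l c v] ->
        forall x, ext_closed x -> v x = u x))
  <->
  ((m = k -> mu_ n k l b (alpha1 R n k l) <= c) /\
   ((k < m)%N -> mu_ n k l b (alpha1 R n k l) <= c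
                 <= mu_ n k l b (alpha2 R n k l m))).

Proof.
have kn := leq_trans hkm hmn; have ln := leq_trans (ltnW hl) kn.
have ck0 : 0 < 'C(n, k)%:R :> R by rewrite ltr0n bin_gt0.
have cl0 : 0 < 'C(n, l)%:R :> R by rewrite ltr0n bin_gt0.
have kl0 : (0 < k - l)%N by rewrite subn_gt0.
have k0 : 0 < k%:R :> R by rewrite ltr0n (leq_ltn_trans _ hl).
have a0 : 0 < a_hat R n k l by rewrite powR_gt0 // divr_gt0.
have aE : 'C(n, k)%:R * a_hat R n k l ^+ (k - l) = 'C(n, l)%:R.
  rewrite powR_invn_expr ?divr_ge0 //.
  by field; rewrite gt_eqF.
have U00 : 0 <= U_low R n k l by exact: powR_ge0.
have U0E : k%:R * 'C(n, k)%:R * U_low R n k l ^+ (k - l) = l%:R * 'C(n, l)%:R.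
  rewrite powR_invn_expr ?divr_ge0 // !natrM.
  by field; rewrite !gt_eqF.
(* For m = k the denominator is zero and [Uh] is a dummy; [UhE] and the upper bound on [c] are
   guarded by [k < m]. *)
pose Uh : R := (((m - l) * 'C(n, l))%:R / ((m - k) * 'C(n, k))%:R)
  `^ (k - l)%:R^-1.
have Uh0 : 0 <= Uh by exact: powR_ge0.
have UhE : (k < m)%N ->
    (m - k)%:R * 'C(n, k)%:R * Uh ^+ (k - l) = (m - l)%:R * 'C(n, l)%:R.
  move=> km; have mk0 : 0 < (m - k)%:R :> R by rewrite ltr0n subn_gt0.
  rewrite powR_invn_expr ?divr_ge0 // !natrM.
  by field; rewrite !gt_eqF.
have A1 : alpha1 R n k l = flux k l 'C(n, k)%:R 'C(n, l)%:R (U_low R n k l).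
  by apply: (@alpha1E R k l _ _ _ (a_hat R n k l)).
have A2 : (k < m)%N ->
    alpha2 R n k l m = flux k l 'C(n, k)%:R 'C(n, l)%:R Uh.
  move=> km; apply: (@alpha2E R k l _ _ (U_low R n k l) (a_hat R n k l)) => //.
have := exterior_iff hl ck0 cl0 U00 U0E a0 aE hn hkm hmn hk Uh0 UhE
  erefl erefl erefl erefl b c.
rewrite -A1 => -[H1 H2]; split.
  move=> /H1[c1 c2]; split=> // km.
  by rewrite c1 A2 ?c2.
move=> [Hk Hm]; apply: H2; split.
  move: hkm; rewrite leq_eqVlt => /orP[/eqP/esym|]; first exact: Hk.
  by move=> /Hm /andP[].
by move=> km; rewrite -A2 //; have /andP[] := Hm km.
Qed.
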